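(* Let $\Bbbk$ be a field, $n\ge 1$, and $f\in\Bbbk[x_1,\dots,x_n]\setminus\Bbbk$. Let $\mathcal{M}$ be the set of all subalgebras $\Bbbk[g]$, $g\in\Bbbk[x_1,\dots,x_n]\setminus\Bbbk$, partially ordered by inclusion, and let $\overline{\Bbbk}$ be an algebraic closure of $\Bbbk$. Consider the following conditions: (i) $f$ is non-composite; (ii) $\Bbbk[f]$ is a maximal element of $\mathcal{M}$; (iii) $f$ is closed; (iv) $f+\lambda$ is irreducible over $\overline{\Bbbk}$ for all but finitely many $\lambda\in\overline{\Bbbk}$; (v) there exists $\lambda\in\overline{\Bbbk}$ such that $f+\lambda$ is irreducible over $\overline{\Bbbk}$; (vi) there exists a family (which may be taken finite) of $\Bbbk$-derivations $\{D_i\}$ of the algebra $\Bbbk[x_1,\dots,x_n]$ such that $\Bbbk[f]=\bigcap_i\operatorname{Ker} D_i$. Then (i), (ii) and (iii) are equivalent. If $\Bbbk$ is a perfect field, then each of (iv) and (v) is also equivalent to them. If $\operatorname{char}\Bbbk=0$, then (vi) is also equivalent to them.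
   Context: A polynomial $f\in\Bbbk[x_1,\dots,x_n]\setminus\Bbbk$ is called closed if the subalgebra $\Bbbk[f]$ is integrally closed in $\Bbbk[x_1,\dots,x_n]$. It is called non-composite if, whenever $f=F(g)$ with $F(t)\in\Bbbk[t]$ and $g\in\Bbbk[x_1,\dots,x_n]$, one has $\deg(F)=1$. ''Irreducible over $\overline{\Bbbk}$'' means irreducible in $\overline{\Bbbk}[x_1,\dots,x_n]$. *)

(* Defs.v *)
From HB Require Import structures.
From mathcomp Require Import all_boot all_order all_algebra all_field.
From mathcomp Require Import mpoly.
From mathcomp Require Import boolp classical_sets.

Set Implicit Arguments.
Unset Strict Implicit.
Unset Printing Implicit Defensive.

Import GRing.Theory.
Local Open Scope classical_set_scope.
Local Open Scope ring_scope.

Definition perfect_field (K : fieldType) : Prop :=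
  forall p : {poly K}, irreducible_poly p -> separable_poly p.

(* A [closedFieldType] is algebraically closed by construction, so only
   algebraicity over the image of [iota] has to be required. *)
Definition is_algebraic_closure (K : fieldType) (L : closedFieldType)
    (iota : {rmorphism K -> L}) : Prop :=
  forall x : L, algebraicOver iota x.

Definition irreducible_element (R : comUnitRingType) (p : R) : Prop :=
  [/\ p != 0, p \isn't a GRing.unit &
      forall a b : R, p = a * b -> a \is a GRing.unit \/ b \is a GRing.unit].

(* [A] is meant to be a subring of [R]; integrality over [A] is witnessed by a
   monic polynomial over [R] all of whose coefficients lie in [A]. *)
Definition integral_over (R : comNzRingType) (A : set R) (h : R) : Prop :=
  exists p : {poly R}, [/\ p \is monic, forall i, A p`_i & root p h].

Definition integrally_closed_in (R : comNzRingType) (A : set R) : Prop :=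
  forall h : R, integral_over A h -> A h.

Definition is_derivation (K : fieldType) (A : comAlgType K)
    (D : {linear A -> A}) : Prop :=
  forall a b : A, D (a * b) = D a * b + a * D b.

Definition maximal_element (T : Type) (M : set (set T)) (A : set T) : Prop :=
  M A /\ forall B, M B -> A `<=` B -> B = A.

Section Conditions.
Variables (K : fieldType) (n : nat).
Implicit Types f g : {mpoly K[n]}.

Definition nonconstant f : Prop := forall c : K, f <> c%:MP.

(* [horner_alg g F] is F(g), so this is the subalgebra K[g]. *)
Definition subalg_gen g : set {mpoly K[n]} := range (horner_alg g).

Definition one_generated_subalgs : set (set {mpoly K[n]}) :=
  [set A | exists2 g, nonconstant g & A = subalg_gen g].

(* [size F = 2] means that F has degree exactly 1. *)
Definition non_composite f : Prop :=
  forall (F : {poly K}) g, f = horner_alg g F -> size F = 2.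

Definition closed_mpoly f : Prop := integrally_closed_in (subalg_gen f).

Definition shift_irreducible (L : closedFieldType) (iota : {rmorphism K -> L})
    f (lambda : L) : Prop :=
  irreducible_element (map_mpoly iota f + lambda%:MP).

Definition is_kernel_of_derivations f (I : Type)
    (D : I -> {linear {mpoly K[n]} -> {mpoly K[n]}}) : Prop :=
  (forall i, is_derivation (D i)) /\
  subalg_gen f = \bigcap_(i in [set: I]) [set h | D i h = 0].

End Conditions.

(* Main.v *)
Require Import Defs.
From HB Require Import structures.
From mathcomp Require Import all_boot all_order all_fingroup all_algebra all_field.
From mathcomp Require Import mpoly.
From mathcomp Require Import boolp classical_sets.
From mathcomp Require Import ring zify.

Set Implicit Arguments.
Unset Strict Implicit.
Unset Printing Implicit Defensive.

Import Order.TTheory GRing.Theory.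
Local Open Scope ring_scope.

(** Conditions (i) and (ii) are equivalent because [F(g)] generates [K[g]]
    exactly when [F] has degree [1]; (iii) implies (i) because [g] is integral
    over [K[F(g)]], and (v) implies (i) because [F + lambda] splits into linear
    factors over an algebraically closed field; (iv) implies (v) because such a
    field is infinite. The other implications rest, at least in part, on
    Kronecker substitution [X_i |-> t^(w i)], with weights [w] that separate
    the monomials of small degree (lemma [kronecker_weights]). It turns [f]
    into a polynomial [fh] in one variable, and it is injective on the elements
    integral over [K[f]].

    (i) implies (iii). This is a form of Luroth's theorem. Among the monic
    divisors of [fh(X) - f] over the fraction field of [K[x]], choose one, [m],
    of minimal degree that vanishes at [X = t] after substitution. Its
    coefficients are integral over [K[f]], since its roots are, and they are
    polynomials, since [K[x]] is integrally closed. A resultant argument shows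
    that [m] divides [h(t)(X) - h] for every [h] integral over [K[f]], where
    [h(t)] is the image of [h] ([minimal_fiber_divisor_dvd]). Comparing degrees
    in [t] and in [X], the image of [m] is [u(X) - u(t)] up to a constant, where
    [u] is the image of one of the coefficients, [g]; so all these [h] are
    polynomials in [g] ([luroth_generator]). This applies to [f] itself, which
    is non-composite, so that [K[g] = K[f]].

    (i) implies (iv). As [K] is perfect and [f] is not a [p]-th power, some
    partial derivative of [f] is nonzero and the weights can be chosen with
    [fh'] nonzero. A factorization of [f - tau] distributes the roots of
    [fh(X) - tau] between the two factors; conversely each set [S] of roots
    decodes to a candidate factorization, whose failure is measured by
    [defect]. The product of the defects over all proper [S] is symmetric in
    the roots, so its coefficients are polynomials in [tau]
    ([total_defect_coef]). It suffices that one of them is a nonzero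
    polynomial, and this is tested on the generic fiber [tau = f(x)], in the
    splitting field of [fh(X) - f] over [K(x)]. There, if [S] has zero defect,
    one of the two candidate factors vanishes at the generic point [x]. The
    traces of multiples of its coefficients are integral over [K[f]], hence in
    [K[f]] because [f] is closed, and they satisfy a relation of degree less
    than that of [fh], hence vanish; the trace form of a separable extension
    being nondegenerate, the candidate factor is zero
    ([generic_part_eq0]), which is absurd.

    (vi). A derivation killing [F(g)] kills [g] in characteristic [0], so (vi)
    implies (i). Conversely the derivations
    [h |-> (df/dx_j) (dh/dx_i) - (df/dx_i) (dh/dx_j)] have common kernel [K[f]]
    when [f] is closed: the leading monomials of the elements [h] of that
    kernel lie on the ray spanned by the leading monomial of [f], which leaves
    no room for [f] and [h] to be algebraically independent
    ([kernel_algebraic]). *)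

(** * Splitting fields *)

Lemma irreducible_factor (F : fieldType) (p : {poly F}) :
  (1 < size p)%N -> exists2 r, r %| p & irreducible_poly r.
Proof.
have [m] := ubnP (size p); elim: m p => // m IHm p lt_pm p_gt1.
have [irr_p|] := pselect (irreducible_poly p); first by exists p.
move=> /not_andP[//|/existsNP[q /not_implyP[q_neq1 /not_implyP[dv_qp nqp]]]].
have p_neq0 : p != 0 by rewrite -size_poly_gt0 ltnW.
have lt_qp : (size q < size p)%N.
  rewrite ltn_neqAle dvdp_leq // andbT (dvdp_size_eqp dv_qp).
  by apply/negP.
have q_gt1 : (1 < size q)%N.
  by rewrite ltn_neqAle eq_sym q_neq1 size_poly_gt0 (dvdpN0 dv_qp).
have [|r dv_rq irr_r] := IHm q _ q_gt1; first exact: leq_trans lt_qp lt_pm.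
by exists r => //; apply: dvdp_trans dv_rq dv_qp.
Qed.

Lemma splitting_extension (F : fieldType) (p : {poly F}) : p != 0 ->
  exists (L : fieldExtType F) (rs : seq L),
    map_poly (in_alg L) p %= \prod_(z <- rs) ('X - z%:P).
Proof.
have [m] := ubnP (size p); elim: m F p => // m IHm F p lt_pm p_neq0.
have [p_le1|p_gt1] := leqP (size p) 1.
  exists F^o, [::].
  by rewrite big_nil -size_poly_eq1 size_map_poly eqn_leq p_le1 size_poly_gt0.
have [r dv_rp irr_r] := irreducible_factor p_gt1.
have [K _ [x rx0 _]] := irredp_FAdjoin irr_r.
have /factor_theorem[q Dp] : root (map_poly (in_alg K) p) x.
  by rewrite -(divpK dv_rp) rmorphM /= rootM rx0 orbT.
have size_p : size p = size (q * ('X - x%:P)).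
  by rewrite -Dp size_map_poly.
have q_neq0 : q != 0.
  move: p_neq0; rewrite -size_poly_eq0 size_p size_poly_eq0.
  by rewrite mulf_eq0 => /norP[].
have [|L [zs Dq]] := IHm K q _ q_neq0.
  move: lt_pm; rewrite ltnS size_p size_mul ?polyXsubC_eq0 // size_XsubC.
  by rewrite addn2.
suffices [rs Drs] : exists rs : seq L,
    map_poly (in_alg L) (map_poly (in_alg K) p) %= \prod_(z <- rs) ('X - z%:P).
  exists (baseFieldType L), rs.
  move: Drs; rewrite -map_poly_comp.
  by rewrite -(eq_map_poly (fun a : F => baseField_scaleE a 1)).
exists (x%:A :: zs); rewrite big_cons Dp mulrC rmorphM /= rmorphB /=.
by rewrite map_polyX map_polyC /= eqp_mull.
Qed.

(** The roots generate a subfield of any extension that splits [p]; that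
    subfield, seen as an extension of its own, is the splitting field. *)
Lemma splitting_field_exists (F : fieldType) (p : {poly F}) : p != 0 ->
  exists L : splittingFieldType F,
    splittingFieldFor 1 (map_poly (in_alg L) p) {:L}.
Proof.
move=> p_neq0.
suffices [L splitL] : exists L : fieldExtType F,
    splittingFieldFor 1 (map_poly (in_alg L) p) {:L}.
  have axL : SplittingField.axiom L.
    exists (map_poly (in_alg L) p) => //.
    by apply/polyOverP => i; rewrite coef_map /= rpredZ ?mem1v.
  pose mix := FieldExt_isSplittingField.Build F L axL.
  pose SL : splittingFieldType F := HB.pack (FieldExt.sort L) mix.
  by exists SL.
have [L [ys Dp]] := splitting_extension p_neq0.
pose E := <<1 & ys>>%AS.
pose toL : 'AHom(subvs_of E, L) := linfun_ahom (vsval : {lrmorphism _ -> _}).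
have toLE u : toL u = vsval u by rewrite lfunE.
pose zs := map (vsproj E) ys.
have Dys : map toL zs = ys.
  rewrite -map_comp map_id_in // => y ys_y.
  by rewrite /= toLE vsprojK ?seqv_sub_adjoin.
exists (subvs_of E), zs.
  rewrite -(eqp_map toL) rmorph_prod -map_poly_comp.
  have -> : map_poly (toL \o in_alg (subvs_of E)) p = map_poly (in_alg L) p.
    by apply: eq_map_poly => a /=; rewrite linearZ /= rmorph1.
  rewrite -Dys big_map in Dp; congr (_ %= _): Dp; apply: eq_bigr => z _.
  by rewrite rmorphB /= map_polyX map_polyC.
apply/vspaceP => u; rewrite memvf.
have : val u \in (toL @: <<1 & zs>>)%VS.
  by rewrite aimg_adjoin_seq aimg1 Dys (valP u).
case/memv_imgP => v zs_v; rewrite toLE => /val_inj ->.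
exact: zs_v.
Qed.

(** * Polynomial rings are integrally closed *)

(** Binomial expansion: if the powers of [p / q] have the common denominator
    [c], so do those of [p / q - t]. *)
Lemma almost_integral_sub (R : comNzRingType) (c p q t : R) :
    (forall k, exists e, c * p ^+ k = q ^+ k * e) ->
  forall k, exists e, c * (p - q * t) ^+ k = q ^+ k * e.
Proof.
move=> /choice[e De] k.
exists (\sum_(i < k.+1) (-1) ^+ i * e (k - i)%N * t ^+ i *+ 'C(k, i)).
rewrite exprBn !mulr_sumr; apply: eq_bigr => i _.
have Dqk : q ^+ k = q ^+ (k - i) * q ^+ i by rewrite -exprD subnK // -ltnS.
rewrite !mulrnAr; congr (_ *+ _); rewrite exprMn Dqk.
transitivity (c * p ^+ (k - i) * ((-1) ^+ i * (q ^+ i * t ^+ i))).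
  by ring.
by rewrite De; ring.
Qed.

(** If [p / q] is almost integral, the leading monomial of [q] divides that of
    [p]: compare leading monomials in [c * p ^+ k = q ^+ k * e] for a large
    [k]. Subtracting a polynomial multiple of [q] from [p] keeps [p / q] almost
    integral and lowers the leading monomial of [p], so the division by [q]
    terminates with remainder [0]. *)
Lemma almost_integral_divides (K : fieldType) (n : nat) (c p q : {mpoly K[n]}) :
    c != 0 -> q != 0 ->
  (forall k, exists e, c * p ^+ k = q ^+ k * e) -> exists z, p = q * z.
Proof.
move=> c_neq0 q_neq0; move: {2}(mlead p) (erefl (mlead p)) => m.
elim/(well_founded_ind (@ltom_wf n)): m p => m IHm p Dm almost_int.
have [->|p_neq0] := eqVneq p 0; first by exists 0; rewrite mulr0.
have le_qp : (mlead q <= mlead p)%MM.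
  apply/mnm_lepP => i; rewrite leqNgt; apply/negP => lt_pq.
  (* For this exponent the gap between [p] and [q] outweighs [c]. *)
  pose k := (mlead c i).+1; have [e De] := almost_int k.
  have cpk_neq0 : c * p ^+ k != 0 by rewrite mulf_neq0 // expf_neq0.
  have e_neq0 : e != 0 by apply: contraNneq cpk_neq0 => e0; rewrite De e0 mulr0.
  have /(congr1 (fun m => mnm_add m 0%MM i)) := congr1 (@mlead _ _) De.
  rewrite !addm0 !mleadM ?expf_neq0 // !mnmDE !mleadX // !mulmnE => Dlead.
  have : (k * (mlead p i).+1 <= mlead c i + mlead p i * k)%N.
    by rewrite Dlead mulnC (leq_trans (leq_mul lt_pq (leqnn k))) ?leq_addr.
  by rewrite mulnS [(k * _)%N]mulnC leq_add2r ltnn.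
pose t := (mleadc p / mleadc q) *: 'X_[mlead p - mlead q] : {mpoly K[n]}.
have lcq_neq0 : mleadc q != 0 by rewrite mleadc_eq0.
have lc_neq0 : mleadc p / mleadc q != 0.
  by rewrite mulf_neq0 ?invr_eq0 // mleadc_eq0.
have lead_tq : mlead (q * t) = mlead p.
  rewrite mleadM ?scaler_eq0 ?negb_or ?lc_neq0 //=.
    by rewrite mleadZ // mleadXm addmC submK.
  by rewrite -(mleadc_eq0 'X_[_]) mleadXm mcoeffX eqxx oner_eq0.
pose p' := p - q * t.
have lc_p' : p'@_(mlead p) = 0.
  rewrite mcoeffB -{2}lead_tq lead_tq.
  have -> : (q * t)@_(mlead p) = mleadc q * (mleadc p / mleadc q).
    rewrite -scalerAr mcoeffZ mulrC; congr (_ * _).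
    by rewrite -[X in _@_X](submK le_qp) mcoeffMX.
  by rewrite mulrC divfK ?subrr.
have le_p' : (mlead p' <= mlead p)%O.
  by apply: le_trans (mleadB_le _ _) _; rewrite lead_tq joinxx.
have [p'0|p'_neq0] := eqVneq p' 0.
  by exists t; apply/eqP; rewrite -subr_eq0; apply/eqP.
have lt_p' : (mlead p' < m)%O.
  rewrite -Dm lt_neqAle le_p' andbT; apply: contraNneq p'_neq0 => Dp'.
  by rewrite -mleadc_eq0 Dp' lc_p'.
have [|z Dz] := IHm _ lt_p' _ erefl.
  exact: almost_integral_sub.
exists (z + t); rewrite mulrDr -Dz /p' subrK //.
Qed.

Local Notation "x %:F" := (@FracField.tofrac _ x) : ring_scope.

Lemma fracP (R : idomainType) (z : {fraction R}) :
  exists p q : R, q != 0 /\ z * q%:F = p%:F.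
Proof.
elim/quotW: z => x; exists (\n_x), (\d_x); split; first exact: denom_ratioP.
unlock FracField.tofrac.
rewrite -[LHS]FracField.pi_mul; apply/eqmodP; rewrite /= FracField.equivfE.
rewrite /FracField.mulf !numden_Ratio ?mulf_neq0 ?oner_neq0 ?denom_ratioP //.
by rewrite !mulr1 mulrC.
Qed.

Lemma tofrac_inj (R : idomainType) : injective (@FracField.tofrac R).
Proof. by move=> x y /eqP; rewrite tofrac_eq => /eqP. Qed.

(** If [p / q] is a root of a monic polynomial of degree [r], then [q ^+ r] is a
    common denominator of all its powers. *)
Lemma mpoly_integrally_closed (K : fieldType) (n : nat)
    (z : {fraction {mpoly K[n]}}) :
  integralOver (@FracField.tofrac {mpoly K[n]}) z -> exists h, z = h%:F.
Proof.
have [p [q [q_neq0 Dz]]] := fracP z; case=> P monP /rootP Pz0.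
have qF_neq0 : q%:F != 0 by rewrite tofrac_eq0.
pose r := (size P).-1.
have Dr : size P = r.+1 by rewrite prednK // size_poly_gt0 monic_neq0.
have zr : z ^+ r = - \sum_(i < r) (P`_i)%:F * z ^+ i.
  move: Pz0; rewrite horner_coef (size_map_inj_poly (@tofrac_inj _)) ?tofrac0 //.
  rewrite Dr big_ord_recr /=.
  rewrite !coef_map /= -[P`_r]/(lead_coef P) (monicP monP) tofrac1 mul1r.
  move/eqP; rewrite addrC addr_eq0 => /eqP ->; congr (- _).
  by apply: eq_bigr => i _; rewrite coef_map.
have almost_int k : exists e, q%:F ^+ r * z ^+ k = e%:F.
  elim/ltn_ind: k => k IHk; have [le_kr|lt_rk] := leqP k r.
    exists (p ^+ k * q ^+ (r - k)).
    rewrite tofracM !tofracXn -Dz exprMn -{1}(subnK le_kr) exprD.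
    by ring.
  have {}IHk (i : 'I_r) : exists e, q%:F ^+ r * z ^+ (i + (k - r)) = e%:F.
    by apply: IHk; have := ltn_ord i; lia.
  have [e De] := choice IHk.
  exists (- \sum_(i < r) P`_i * e i).
  rewrite -(subnK (ltnW lt_rk)) exprD zr tofracN rmorph_sum /= mulrN mulrN.
  congr (- _); rewrite !mulr_sumr; apply: eq_bigr => i _.
  by rewrite tofracM -De exprD; ring.
have [|h Dh] := almost_integral_divides (p := p) (expf_neq0 r q_neq0) q_neq0.
  move=> k; have [e De] := almost_int k; exists e; apply/eqP.
  by rewrite -tofrac_eq !tofracM !tofracXn -Dz exprMn -De; apply/eqP; ring.
by exists h; apply: (mulIf qF_neq0); rewrite Dz Dh tofracM mulrC.
Qed.

(** * Kronecker substitution *)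

Section Kronecker.

Variables (n : nat) (w : 'I_n -> nat).

Definition weight (m : 'X_{1..n}) : nat := (\sum_i m i * w i)%N.

Definition separates_monomials (B : nat) : Prop :=
  forall m m' : 'X_{1..n}, (mdeg m < B)%N -> (mdeg m' < B)%N ->
    weight m = weight m' -> m = m'.

Section Ring.
Variable R : comNzRingType.
Implicit Types (p q : {mpoly R[n]}) (P Q : {poly R}).

Definition kron p : {poly R} := mmap polyC (fun i => 'X^(w i)) p.

HB.instance Definition _ := GRing.RMorphism.copy kron
  (mmap (@polyC R) (fun i : 'I_n => 'X^(w i))).

(** A left inverse of [kron] on polynomials of degree less than [B]. *)
Definition dekron (B : nat) P : {mpoly R[n]} :=
  \sum_(m : 'X_{1..n < B}) P`_(weight m) *: 'X_[m].

Lemma kronE p : kron p = \sum_(m <- msupp p) p@_m *: 'X^(weight m).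
Proof.
apply: eq_bigr => m _; rewrite mul_polyC; congr (_ *: _).
rewrite /mmap1 /weight -prodrXr; apply: eq_bigr => i _.
by rewrite -exprM mulnC.
Qed.

Lemma kronX m : kron 'X_[m] = 'X^(weight m).
Proof. by rewrite kronE msuppX big_seq1 mcoeffX eqxx scale1r. Qed.

Lemma kronC c : kron c%:MP = c%:P.
Proof. exact: mmapC. Qed.

Lemma mcoeff_dekron B P m :
  (dekron B P)@_m = if (mdeg m < B)%N then P`_(weight m) else 0.
Proof.
case: ltnP => [lt_mB|le_Bm].
  exact: (@mcoeff_mpoly n R (fun m => P`_(weight m)) m B lt_mB).
rewrite raddf_sum big1 //= => m' _; rewrite mcoeffZ mcoeffX.
by case: eqP => [Dm|_]; [have := bmdeg m'; rewrite Dm ltnNge le_Bm | rewrite mulr0].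
Qed.

Lemma dekronZ B c P : dekron B (c *: P) = c *: dekron B P.
Proof.
apply/mpolyP => m; rewrite mcoeffZ !mcoeff_dekron coefZ.
by case: ifP => // _; rewrite mulr0.
Qed.

Variable B : nat.
Hypothesis sepB : separates_monomials B.

Lemma coef_kron p m : (msize p <= B)%N -> (mdeg m < B)%N ->
  (kron p)`_(weight m) = p@_m.
Proof.
move=> le_pB lt_mB; rewrite kronE coef_sum.
have lt_supp m' : m' \in msupp p -> (mdeg m' < B)%N.
  by move/msize_mdeg_lt/leq_trans; apply.
rewrite [in RHS](mpolyE p) raddf_sum /= !big_seq; apply: eq_bigr => m' p_m'.
rewrite coefZ coefXn mcoeffZ mcoeffX; congr (_ * (nat_of_bool _)%:R).
apply/idP/idP => /eqP => [eq_w|-> //].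
by apply/eqP/esym/sepB => //; apply: lt_supp.
Qed.

Lemma kronK p : (msize p <= B)%N -> dekron B (kron p) = p.
Proof.
move=> le_pB; apply/mpolyP => m; rewrite mcoeff_dekron.
case: ltnP => [lt_mB|le_Bm]; first by rewrite coef_kron.
by apply/esym/memN_msupp_eq0/msize_mdeg_ge/(leq_trans le_pB).
Qed.

Lemma kron_size_gt1 p : (forall i, 0 < w i)%N -> (msize p <= B)%N ->
  (1 < msize p)%N -> (1 < size (kron p))%N.
Proof.
move=> w_gt0 le_pB p_gt1.
have p_neq0 : p != 0 by rewrite -msize_poly_eq0 -lt0n ltnW.
have Dlead := mlead_deg p_neq0.
have lead_gt0 : (0 < mdeg (mlead p))%N by rewrite -ltnS Dlead.
have coef_neq0 : (kron p)`_(weight (mlead p)) != 0.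
  by rewrite coef_kron // ?mleadc_eq0 // Dlead.
have weight_gt0 : (0 < weight (mlead p))%N.
  apply: leq_trans lead_gt0 _; rewrite mdegE; apply: leq_sum => i _.
  by rewrite leq_pmulr.
rewrite ltnNge; apply: contra coef_neq0 => le1.
by rewrite nth_default // (leq_trans le1).
Qed.

End Ring.

Lemma dekron_map (R S : comNzRingType) (g : {rmorphism R -> S}) B (P : {poly R}) :
  dekron B (map_poly g P) = map_mpoly g (dekron B P).
Proof.
apply/mpolyP => m; rewrite mcoeff_map_mpoly !mcoeff_dekron coef_map.
by case: ifP => // _; rewrite raddf0.
Qed.

Lemma kron_map (R S : comNzRingType) (g : {rmorphism R -> S}) (p : {mpoly R[n]}) :
  kron (map_mpoly g p) = map_poly g (kron p).
Proof.
elim/mpolyind: p => [|c m p _ _ IHp]; first by rewrite !raddf0.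
rewrite !raddfD /= IHp; congr (_ + _).
rewrite map_mpolyZ -!mul_mpolyC !rmorphM /= !kronC map_mpolyX !kronX.
by rewrite map_polyC map_polyXn.
Qed.

Lemma kron_horner (K : fieldType) (f : {mpoly K[n]}) (q : {poly K}) :
  kron (horner_alg f q) = q \Po kron f.
Proof.
rewrite /horner_alg /= /horner_morph -horner_map -map_poly_comp /=.
congr (_.[_]); apply: eq_map_poly => c /=.
by rewrite alg_mpolyC kronC.
Qed.

End Kronecker.

Lemma digits_inj (N M : nat) (c c' : nat -> nat) :
    (forall k, c k < N)%N -> (forall k, c' k < N)%N ->
    (\sum_(k < M) c k * N ^ k = \sum_(k < M) c' k * N ^ k)%N ->
  forall k, (k < M)%N -> c k = c' k.
Proof.
elim: M c c' => // M IHM c c' ltc ltc'; rewrite !big_ord_recl !expn0 !muln1.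
have shift d : (\sum_(i < M) d (bump 0 i) * N ^ bump 0 i =
    (\sum_(i < M) d i.+1 * N ^ i) * N)%N.
  by rewrite big_distrl; apply: eq_bigr => i _; rewrite /= expnSr mulnA.
rewrite !shift => eq_sum.
have eq0 : c 0%N = c' 0%N.
  have /(congr1 (fun x => x %% N)%N) := eq_sum.
  by rewrite ![(_ + _ * N)%N]addnC !modnMDl !modn_small.
have N_gt0 : (0 < N)%N by apply: leq_ltn_trans (ltc 0%N).
case=> [//|k]; rewrite ltnS; apply: (IHM (c \o S) (c' \o S)) => [i|i|].
- exact: ltc.
- exact: ltc'.
by apply/eqP; rewrite -(eqn_pmul2r N_gt0) -(eqn_add2l (c 0%N)) {2}eq0 eq_sum.
Qed.

(** The variable [i0] gets weight [1] and the other variables get distinct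
    positive powers of a base [N] that exceeds all exponents. When [K] has
    characteristic [p], the base is a multiple of [p], so that the weight of a
    monomial is congruent mod [p] to its exponent in [i0]: this is what keeps
    the derivative alive. *)
Lemma kronecker_weights (K : fieldType) (n B : nat) (i0 : 'I_n) :
  exists w : 'I_n -> nat,
    [/\ forall i, (0 < w i)%N, separates_monomials w B &
        forall m : 'X_{1..n}, (m i0)%:R != 0 :> K -> (weight w m)%:R != 0 :> K].
Proof.
(* [e] is the characteristic of [K], or [1] in characteristic [0]. *)
have [e e_gt0 e_char] : exists2 e : nat, (0 < e)%N &
    e%:R = 0 :> K \/ [pchar K] =i pred0.
  have [[p charp]|nochar] := pselect (exists p, p \in [pchar K]).
    exists p; first by apply: prime_gt0; case/andP: charp.
    by left; apply/eqP; case/andP: charp.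
  exists 1%N => //; right=> p; apply/negbTE/negP => charp.
  by apply: nochar; exists p.
pose N := (e * B.+1)%N.
have ltB d : (d < B)%N -> (d < N)%N by move=> ?; rewrite /N; nia.
pose pos (j : 'I_n) := if j == i0 then 0%N else j.+1.
have pos_inj : injective pos.
  move=> i j; rewrite /pos; case: eqP => [->|_]; case: eqP => [->|_] //.
  by case=> /val_inj.
have pos_lt j : (pos j < n.+1)%N.
  by rewrite /pos; case: ifP => // _; rewrite ltnS.
exists (fun j => N ^ pos j)%N; split=> [i|m m' lt_m lt_m'|m m_neq0].
- by rewrite expn_gt0 muln_gt0 e_gt0.
- pose c (m : 'X_{1..n}) k := (\sum_(j | pos j == k) m j)%N.
  have c_lt m1 k : (mdeg m1 < B)%N -> (c m1 k < N)%N.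
    move=> lt_m1; apply/ltB/(leq_ltn_trans _ lt_m1).
    by rewrite mdegE [leqRHS](bigID (fun j => pos j == k)) leq_addr.
  have weightE m1 : weight (fun j => N ^ pos j)%N m1 =
      (\sum_(k < n.+1) c m1 k * N ^ k)%N.
    rewrite /weight (partition_big (fun j => Ordinal (pos_lt j)) predT) //=.
    apply: eq_bigr => k _; rewrite /c big_distrl /=.
    apply: eq_big => [j|j /eqP <- //]; by rewrite -val_eqE.
  rewrite !weightE => /(digits_inj (fun k => c_lt _ k lt_m)).
  move=> /(_ (fun k => c_lt _ k lt_m')) eq_c.
  apply/mnmP => j; have := eq_c _ (pos_lt j); rewrite /c.
  have predE i : (pos i == pos j) = (i == j) by apply: inj_eq.
  by under eq_bigl do rewrite predE; rewrite big_pred1_eq;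
     under eq_bigl do rewrite predE; rewrite big_pred1_eq.
have Dw : weight (fun j => N ^ pos j)%N m =
    (m i0 + \sum_(j | j != i0) m j * N ^ pos j)%N.
  by rewrite /weight (bigD1 i0) //= {1}/pos eqxx expn0 muln1.
case: e_char => [e0|char0].
  rewrite Dw natrD natr_sum big1 ?addr0 // => j /negbTE j_neq.
  by rewrite /pos j_neq expnS /N natrM natrM natrM e0 !(mul0r, mulr0).
move: m_neq0; rewrite !(pcharf0P _).1 //; apply: contraNN => /eqP w0.
by move: w0; rewrite Dw => /eqP; rewrite addn_eq0 => /andP[].
Qed.

Lemma kron_deriv_neq0 (K : fieldType) (n B : nat) (w : 'I_n -> nat) (i0 : 'I_n)
    (f : {mpoly K[n]}) :
    separates_monomials w B -> (msize f <= B)%N ->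
    (forall m : 'X_{1..n}, (m i0)%:R != 0 :> K -> (weight w m)%:R != 0 :> K) ->
  f^`M(i0) != 0 -> (kron w f)^`() != 0.
Proof.
move=> sepB le_fB weight_neq0 df_neq0.
pose m := (mlead f^`M(i0) + U_(i0))%MM.
have : (f^`M(i0))@_(mlead f^`M(i0)) != 0 by rewrite mleadc_eq0.
rewrite mcoeff_deriv -/m -mulr_natr mulf_eq0 negb_or => /andP[fm_neq0].
have Dm : m i0 = (mlead f^`M(i0) i0).+1 by rewrite mnmDE mnm1E eqxx addn1.
rewrite -Dm => /weight_neq0 wm_neq0.
have lt_mB : (mdeg m < B)%N.
  by apply: leq_trans le_fB; apply: msize_mdeg_lt; rewrite mcoeff_msupp.
have wm_gt0 : (0 < weight w m)%N.
  by rewrite lt0n; apply: contraNneq wm_neq0 => ->.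
apply/eqP => /polyP/(_ (weight w m).-1); rewrite coef_deriv coef0 prednK //.
rewrite (coef_kron sepB) // -mulr_natr => /eqP.
by rewrite mulf_eq0 (negbTE fm_neq0) (negbTE wm_neq0).
Qed.

(** * Separated polynomials in two variables *)

Section Separated.

Variable K : fieldType.
Implicit Types (u v : {poly K}) (mu : {poly {poly K}}).

Definition sepp u : {poly {poly K}} := u^:P - u%:P.

Lemma size_sepp u : (1 < size u)%N -> size (sepp u) = size u.
Proof.
move=> u_gt1; rewrite size_polyDl size_map_polyC // size_polyN.
by rewrite (leq_ltn_trans (size_polyC_leq1 _)).
Qed.

Lemma swapXY_sepp u : swapXY (sepp u) = - sepp u.
Proof. by rewrite rmorphB /= swapXY_map_polyC swapXY_polyC opprB. Qed.

(** Since [u(X)] equals [u(t)] modulo [sepp u], the [u]-adic expansion of [v(X)]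
    leaves a remainder [W] with coefficients in [K[u(t)]]; only the constant
    coefficient of [W] is recorded. *)
Lemma sepp_remainder u v : (1 < size u)%N ->
  exists e W F, [/\ v^:P = sepp u * e + W, (size W < size u)%N & W`_0 = F \Po u].
Proof.
move=> u_gt1; have [m] := ubnP (size v); elim: m v => // m IHm v lt_vm.
have [lt_vu|le_uv] := ltnP (size v) (size u).
  exists 0, v^:P, (v`_0)%:P; rewrite mulr0 add0r size_map_polyC coef_map.
  by rewrite comp_polyC.
have u_neq0 : u != 0 by rewrite -size_poly_gt0 ltnW.
have [|e [W [F [Da lt_Wu W0]]]] := IHm (v %/ u).
  rewrite size_divp //.
  move: u_gt1 le_uv lt_vm; case: (size u) => [|[|a]] //= _.
  by case: (size v) => [|b] //; rewrite subSS => _; rewrite ltnS; apply/leq_ltn_trans/leq_subr.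
exists ((v %/ u)^:P + u%:P * e), (u%:P * W + (v %% u)^:P).
exists ('X * F + ((v %% u)`_0)%:P); split.
- rewrite {1}(divp_eq v u) rmorphD rmorphM /= mulrDr addrA; congr (_ + _).
  have -> : u^:P = sepp u + u%:P by rewrite subrK.
  by rewrite [LHS]mulrDr {2}Da; ring.
- rewrite (leq_ltn_trans (size_polyD _ _)) // gtn_max size_map_polyC ltn_modp.
  by rewrite u_neq0 andbT mul_polyC (leq_ltn_trans (size_scale_leq _ _)).
- rewrite coefD coefCM W0 coef_map /= comp_polyD comp_polyM comp_polyX.
  by rewrite comp_polyC.
Qed.

(** The remainder of [v(X)] modulo [sepp u] is also [v(t)], so the latter lies
    in [K[u(t)]]. *)
Lemma sepp_dvd_comp u v e : (1 < size u)%N -> sepp v = sepp u * e ->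
  exists F, v = F \Po u.
Proof.
move=> u_gt1 Dv; have [e' [W [F [Dv' lt_Wu W0]]]] := sepp_remainder v u_gt1.
exists F; rewrite -W0.
have DW : W - v%:P = sepp u * (e - e').
  by rewrite mulrBr -Dv {1}/sepp Dv'; ring.
have lt_size : (size (W - v%:P)%R < size u)%N.
  rewrite (leq_ltn_trans (size_polyD _ _)) // gtn_max lt_Wu size_polyN.
  by rewrite (leq_ltn_trans (size_polyC_leq1 _)).
suffices /eqP : W - v%:P = 0 by rewrite subr_eq0 => /eqP ->; rewrite coefC.
apply: contraTeq lt_size => W_neq0; rewrite -leqNgt -(size_sepp u_gt1).
move: W_neq0; rewrite DW mulf_eq0 negb_or => /andP[D_neq0 x_neq0].
by rewrite size_mul // -subn1 -addnBA ?leq_addr // size_poly_gt0.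
Qed.

(** A monic [mu] in [K[t][X]] with root [t] plays the role of the minimal
    polynomial of [t] over a subfield of [K(t)]. If [u] is a coefficient of
    [mu] of maximal degree in [t], then [sepp u] is a multiple of [mu] of the
    same degree in [t], so the cofactor only involves [X]; comparing the
    leading coefficients in [t], the cofactor is a constant. Divisibility by
    [mu] is then divisibility by [sepp u]. *)
Lemma luroth_generator mu : mu \is monic -> mu.['X] = 0 ->
    (forall i, exists e, sepp mu`_i = mu * e) ->
  exists i, forall v e, sepp v = mu * e -> exists F, v = F \Po mu`_i.
Proof.
move=> mon_mu mu_root sepp_mu.
have mu_neq0 := monic_neq0 mon_mu.
have mu_gt0 : (0 < size mu)%N by rewrite size_poly_gt0.
have [i Di] : exists i, size mu`_i = sizeY mu.
  have [|i Di] := bigop.eq_bigmax (fun i : 'I_(size mu) => size mu`_i).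
    by rewrite card_ord.
  by exists i; rewrite -Di.
exists i => v e Dv; set u := mu`_i; have [q Dq] := sepp_mu i.
have u_gt1 : (1 < size u)%N.
  rewrite ltnNge; apply: contraNN mu_neq0; rewrite Di => mu_le1.
  have Dmu : mu = (map_poly (fun c : {poly K} => c`_0) mu)^:P.
    apply/polyP => j; rewrite !coef_map_id0 ?coef0 //; apply: size1_polyC.
    exact: leq_trans (max_size_coefXY _ _) mu_le1.
  move: mu_root; rewrite {1}Dmu -[_.['X]]/(_ \Po 'X) comp_polyXr => mu0.
  by rewrite Dmu mu0 map_polyC.
have size_swap : size (swapXY (sepp u)) = size u.
  by rewrite swapXY_sepp size_polyN size_sepp.
have sepp_neq0 : sepp u != 0 by rewrite -size_poly_gt0 size_sepp // ltnW.
have q_neq0 : q != 0 by apply: contraNneq sepp_neq0 => q0; rewrite Dq q0 mulr0.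
have /size_poly1P[c c_neq0 Dc] : size (swapXY q) == 1%N.
  have := size_swap; rewrite Dq rmorphM size_mul ?swapXY_eq0 //= -sizeYE.
  rewrite -Di -/u; have : (0 < size (swapXY q))%N.
    by rewrite size_poly_gt0 swapXY_eq0.
  case: (size u) u_gt1 => // a _; case: (size (swapXY q)) => // b _.
  by rewrite addnS /= => /eqP; rewrite -[X in _ == X]addn0 eqn_add2l => /eqP ->.
have /size_poly1P[d d_neq0 Dd] : size c == 1%N.
  have := congr1 lead_coef (congr1 (@swapXY K) Dq).
  rewrite swapXY_sepp rmorphM /= lead_coefM lead_coefN Dc lead_coefC.
  rewrite {1}/sepp lead_coefDl; last first.
    by rewrite size_polyN size_map_polyC (leq_ltn_trans (size_polyC_leq1 _)).
  rewrite lead_coef_map_inj //; last exact: polyC_inj.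
  move=> /(congr1 (fun p : {poly K} => size p)).
  rewrite size_polyN size_polyC lead_coef_eq0 -size_poly_gt0 ltnW //=.
  rewrite size_mul ?lead_coef_eq0 ?swapXY_eq0 //.
  have eq1 (a b : nat) : (0 < a)%N -> (0 < b)%N -> 1%N = (a + b).-1 -> b == 1%N.
    by case: a b => [|a] [|[|b]] //= _ _; rewrite !addnS.
  apply: eq1; first by rewrite size_poly_gt0 lead_coef_eq0 swapXY_eq0.
  by rewrite size_poly_gt0.
apply: (@sepp_dvd_comp _ _ ((d^-1)%:P%:P * e) u_gt1).
have -> : sepp u = mu * d%:P%:P.
  rewrite Dq; congr (_ * _); rewrite -[q]swapXYK Dc Dd.
  by rewrite swapXY_polyC map_polyC.
rewrite Dv -mulrA [d%:P%:P * _]mulrA -!polyCM divff // ?mulVf // mul1r.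
by [].
Qed.

End Separated.

(** * Integral elements *)

Section IntegralClosure.

Variables (R S : comNzRingType) (rho : {rmorphism R -> S}).

Lemma integral_sum (I : Type) (r : seq I) (P : pred I) (F : I -> S) :
  (forall i, P i -> integralOver rho (F i)) ->
  integralOver rho (\sum_(i <- r | P i) F i).
Proof.
by move=> intF; apply: big_ind => //; [exact: integral0|exact: integral_add].
Qed.

Lemma integral_prod (I : Type) (r : seq I) (P : pred I) (F : I -> S) :
  (forall i, P i -> integralOver rho (F i)) ->
  integralOver rho (\prod_(i <- r | P i) F i).
Proof.
by move=> intF; apply: big_ind => //; [exact: integral1|exact: integral_mul].
Qed.

Lemma integral_exp x k : integralOver rho x -> integralOver rho (x ^+ k).
Proof.
move=> intx; elim: k => [|k IHk]; first exact: integral1.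
by rewrite exprS; apply: integral_mul.
Qed.

Lemma integral_det (n : nat) (A : 'M[S]_n) :
  (forall i j, integralOver rho (A i j)) -> integralOver rho (\det A).
Proof.
move=> intA; apply: integral_sum => s _; apply: integral_mul.
  by apply/integral_exp/integral_opp/integral1.
by apply: integral_prod.
Qed.

Lemma integral_resultant (p q : {poly S}) :
    (forall i, integralOver rho p`_i) -> (forall i, integralOver rho q`_i) ->
  integralOver rho (resultant p q).
Proof.
move=> intp intq; apply: integral_det => i j; rewrite Sylvester_mxE /=.
by case: split => k; case: leqP => _; rewrite ?mulr1n ?mulr0n //; exact: integral0.
Qed.

Lemma integral_coefM (p q : {poly S}) :
    (forall i, integralOver rho p`_i) -> (forall i, integralOver rho q`_i) ->
  forall i, integralOver rho (p * q)`_i.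
Proof.
move=> intp intq i; rewrite coefM.
by apply: integral_sum => j _; apply: integral_mul.
Qed.

Lemma integral_coef_XsubC x : integralOver rho x ->
  forall i, integralOver rho ('X - x%:P)`_i.
Proof.
move=> intx i; rewrite coefB coefX coefC.
by apply: integral_sub; [exact: integral_nat|case: ifP => // _; exact: integral0].
Qed.

Lemma integral_coef_prod_XsubC (I : eqType) (r : seq I) (F : I -> S) :
    (forall x, x \in r -> integralOver rho (F x)) ->
  forall i, integralOver rho (\prod_(x <- r) ('X - (F x)%:P))`_i.
Proof.
move=> intF; rewrite big_seq; apply: (big_ind (fun p : {poly S} =>
  forall i, integralOver rho p`_i)) => [i|p q|x /intF intx].
- by rewrite coef1; exact: integral_nat.
- exact: integral_coefM.
- exact: integral_coef_XsubC.
Qed.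

End IntegralClosure.

Lemma integral_unit_root (R : idomainType) (S : comNzRingType)
    (rho : {rmorphism R -> S}) (p : {poly R}) x :
  lead_coef p \is a GRing.unit -> root (map_poly rho p) x -> integralOver rho x.
Proof.
move=> Up px0; exists ((lead_coef p)^-1 *: p).
  by rewrite monicE lead_coefZ mulVr.
rewrite map_polyZ /= /root hornerZ.
by move: px0; rewrite /root => /eqP ->; rewrite mulr0.
Qed.

Lemma map_unit_lead_neq0 (R S : unitRingType) (rho : {rmorphism R -> S})
    (p : {poly R}) :
  lead_coef p \is a GRing.unit -> map_poly rho p != 0.
Proof.
move=> Up; apply: contraTneq (rmorph_unit rho Up) => p0.
by rewrite /lead_coef -coef_map p0 coef0 unitr0.
Qed.

Lemma integral_descent (R S T : nzRingType) (rho : {rmorphism R -> S})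
    (phi : {rmorphism S -> T}) x :
  injective phi -> integralOver (phi \o rho) (phi x) -> integralOver rho x.
Proof.
move=> phi_inj [p mon_p px0]; exists p => //; move: px0.
rewrite /root => /eqP px0; apply/eqP/phi_inj; rewrite rmorph0 -px0.
by rewrite -horner_map map_poly_comp.
Qed.

(** A nonzero element [y] of the integral closure is a root of a polynomial
    with nonzero constant term, and that term would have to vanish together
    with the image of [y]. *)
Lemma integral_inj (R S T : idomainType) (rho : {rmorphism R -> S})
    (phi : {rmorphism S -> T}) y :
    (forall q, phi (rho q) = 0 -> q = 0) ->
  integralOver rho y -> phi y = 0 -> y = 0.
Proof.
move=> inj_rho [p mon_p py0] phiy0; apply/eqP/idPn => y_neq0.
have [m] := ubnP (size p); have := monic_neq0 mon_p.
elim: m p py0 {mon_p} => // m IHm p /rootP py0 p_neq0 lt_pm.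
have [p0|p0_neq0] := eqVneq p`_0 0; last first.
  case/eqP: p0_neq0; apply: inj_rho.
  have := congr1 phi py0; rewrite -horner_map phiy0 horner_coef0 rmorph0.
  by rewrite !coef_map.
have /factor_theorem[q Dp] : root p 0 by rewrite /root horner_coef0 p0.
have q_neq0 : q != 0 by apply: contraNneq p_neq0 => q0; rewrite Dp q0 mul0r.
apply: (IHm q) => //.
  move: py0; rewrite Dp subr0 rmorphM /= map_polyX hornerM hornerX.
  by move/eqP; rewrite mulf_eq0 (negbTE y_neq0) orbF.
by move: lt_pm; rewrite Dp subr0 size_mulX.
Qed.

Section ClosureInPolynomials.

Variables (K : fieldType) (n : nat) (f : {mpoly K[n]}).
Local Notation rho := (horner_alg f : {rmorphism {poly K} -> {mpoly K[n]}}).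
Local Notation frac := {fraction {mpoly K[n]}}.
Local Notation toF := (@FracField.tofrac {mpoly K[n]}).

Lemma closed_mpolyP :
  closed_mpoly f <-> (forall h, integralOver rho h -> exists q, h = rho q).
Proof.
split=> clf h [p].
  move=> mon_p ph0; have [|q _ <-] := clf h; last by exists q.
  exists (map_poly rho p); split=> // [|i]; first by rewrite monic_map.
  by rewrite coef_map; exists p`_i.
case=> mon_p p_coef ph0.
have /choice[q Dq] i : exists qi, rho qi = p`_i.
  by case: (p_coef i) => q _ Dq; exists q.
(* The leading coefficient [1] is lifted to [1]. *)
pose q' i := if i == (size p).-1 then 1 else q i.
have Dq' i : rho (q' i) = p`_i.
  rewrite /q'; case: eqP => [->|_]; last exact: Dq.
  by rewrite rmorph1 -[RHS]/(lead_coef p) (monicP mon_p).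
have size_p : (0 < size p)%N by rewrite size_poly_gt0 monic_neq0.
have Dp : map_poly rho (\poly_(i < size p) q' i) = p.
  apply/polyP => i; rewrite coef_map coef_poly; case: ltnP => [_|le_pi].
    exact: Dq'.
  by rewrite raddf0 nth_default.
have [|x Dx] := clf h; last by exists x.
exists (\poly_(i < size p) q' i); last by rewrite Dp.
by rewrite monicE lead_coef_poly ?/q' ?eqxx // oner_neq0.
Qed.

Lemma integral_frac (z : frac) : integralOver (toF \o rho) z ->
  exists2 h, z = h%:F & integralOver rho h.
Proof.
move=> int_z; have [|h Dh] := @mpoly_integrally_closed K n z.
  case: int_z => p mon_p pz0; exists (map_poly rho p); first by rewrite monic_map.
  by rewrite -map_poly_comp.
by exists h => //; move: int_z; rewrite Dh; apply/integral_descent/tofrac_inj.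
Qed.

Variable fh : {poly K}.
Hypothesis fh_gt1 : (1 < size fh)%N.

(** The polynomial [fh(X) - T] in [K[T][X]]; [T] will be sent to [f]. *)
Definition fiber_poly : {poly {poly K}} := fh^:P - 'X%:P.

Lemma size_fiber_poly : size fiber_poly = size fh.
Proof.
by rewrite size_polyDl size_map_polyC // size_polyN (leq_ltn_trans (size_polyC_leq1 _)).
Qed.

Lemma lead_coef_fiber_poly : lead_coef fiber_poly = (lead_coef fh)%:P.
Proof.
rewrite lead_coefDl; first by rewrite lead_coef_map_inj //; exact: polyC_inj.
by rewrite size_polyN size_map_polyC (leq_ltn_trans (size_polyC_leq1 _)).
Qed.

Lemma lead_coef_fiber_poly_unit : lead_coef fiber_poly \is a GRing.unit.
Proof.
rewrite lead_coef_fiber_poly poly_unitE coefC eqxx size_polyC lead_coef_eq0.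
by rewrite -size_poly_gt0 ltnW //= unitfE lead_coef_eq0 -size_poly_gt0 ltnW.
Qed.

(** The roots of a monic divisor of [fh(X) - f] are integral over [K[f]], hence
    so are its coefficients, and polynomial rings are integrally closed. *)
Lemma monic_divisor_integral (m : {poly frac}) :
    m \is monic -> m %| map_poly (toF \o rho) fiber_poly ->
  exists2 m', m = map_poly toF m' & forall i, integralOver rho m'`_i.
Proof.
move=> mon_m dv_m.
have fib_neq0 : map_poly (toF \o rho) fiber_poly != 0.
  exact: (map_unit_lead_neq0 _ lead_coef_fiber_poly_unit).
have [E [rs Drs _]] := splitting_field_exists fib_neq0.
have [|b Dm] := @dvdp_prod_XsubC _ _ rs id (map_poly (in_alg E) m).
  by rewrite -(eqp_dvdr _ Drs) dvdp_map.
have {}Dm : map_poly (in_alg E) m = \prod_(i <- mask b rs) ('X - i%:P).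
  by apply/eqP; rewrite -eqp_monic ?monic_map ?monic_prod_XsubC.
have int_m i : integralOver (toF \o rho) m`_i.
  apply: (@integral_descent _ _ _ _ (in_alg E)); first exact: fmorph_inj.
  rewrite -coef_map Dm; apply: integral_coef_prod_XsubC => x /mem_mask rs_x.
  apply: (integral_unit_root lead_coef_fiber_poly_unit).
  by rewrite map_poly_comp (eqp_root Drs) root_prod_XsubC.
have /choice[h Dh] i : exists h, m`_i = h%:F /\ integralOver rho h.
  by have [x] := integral_frac (int_m i); exists x.
exists (\poly_(i < size m) h i) => [|i].
  apply/polyP => i; rewrite coef_map coef_poly.
  by case: ltnP => [_|le_mi]; [case: (Dh i) | rewrite nth_default // tofrac0].
by rewrite coef_poly; case: ifP => _; [case: (Dh i) | exact: integral0].
Qed.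

End ClosureInPolynomials.

(** * Non-composite polynomials are closed *)

Lemma horner_alg_comp (K : fieldType) (A : comAlgType K) (f : A) (F L : {poly K}) :
  horner_alg (horner_alg f L) F = horner_alg f (F \Po L).
Proof.
elim/poly_ind: F => [|F c IHF]; first by rewrite comp_poly0 !raddf0.
rewrite comp_polyD comp_polyM comp_polyX comp_polyC !rmorphD !rmorphM /=.
by rewrite !horner_algX !horner_algC IHF.
Qed.

Lemma degree1_generator (K : fieldType) (A : comAlgType K) (f g : A) (F : {poly K}) :
  f = horner_alg g F -> size F = 2%N -> exists L, g = horner_alg f L.
Proof.
move=> -> F_2; have F1_neq0 : F`_1 != 0.
  by rewrite -[F`_1]/(F`_(2.-1)) -F_2 -/(lead_coef F) lead_coef_eq0 -size_poly_gt0 F_2.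
exists ((F`_1)^-1 *: ('X - (F`_0)%:P)); rewrite horner_alg_comp.
rewrite comp_polyZ comp_polyB comp_polyX comp_polyC.
have -> : F = F`_1 *: 'X + (F`_0)%:P.
  apply/polyP => i; rewrite coefD coefZ coefX coefC.
  case: i => [|[|i]] /=; rewrite ?mulr0 ?add0r ?mulr1 ?addr0 //.
  by rewrite nth_default // F_2.
rewrite !(coefD, coefZ, coefX, coefC) /= mulr0 add0r mulr1 addr0 addrK.
by rewrite scalerA mulVf // scale1r horner_algX.
Qed.

Lemma monic_dvdp_frac (R : idomainType) (m p : {poly R}) : m \is monic ->
    map_poly (@FracField.tofrac R) m %| map_poly (@FracField.tofrac R) p ->
  exists e, p = m * e.
Proof.
move=> mon_m dv_mp; exists (p %/ m); rewrite mulrC.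
rewrite [LHS](Pdiv.IdomainMonic.divp_eq mon_m p); set r := p %% m.
have lt_rm : (size r < size m)%N by rewrite ltn_modp monic_neq0.
suffices -> : r = 0 by rewrite addr0.
apply/eqP; apply: contraTT lt_rm => r_neq0; rewrite -leqNgt.
have size_F (q : {poly R}) : size (map_poly (@FracField.tofrac R) q) = size q.
  by rewrite (size_map_inj_poly (@tofrac_inj _)) ?tofrac0.
rewrite -(size_F m) -(size_F r); apply: dvdp_leq.
  by rewrite -size_poly_gt0 size_F size_poly_gt0.
move: dv_mp; rewrite (Pdiv.IdomainMonic.divp_eq mon_m p) rmorphD rmorphM /=.
by rewrite dvdp_addr // dvdp_mull.
Qed.

Section Closed.

Variables (K : fieldType) (n : nat) (f : {mpoly K[n]}) (w : 'I_n -> nat).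
Local Notation rho := (horner_alg f : {rmorphism {poly K} -> {mpoly K[n]}}).
Local Notation toF := (@FracField.tofrac {mpoly K[n]}).
Local Notation phi := (@kron n w K : {rmorphism {mpoly K[n]} -> {poly K}}).
Local Notation fh := (kron w f).
Hypothesis fh_gt1 : (1 < size fh)%N.

Lemma kron_integral_inj h : integralOver rho h -> phi h = 0 -> h = 0.
Proof.
apply: integral_inj => q /=; rewrite kron_horner => /eqP.
by rewrite comp_poly_eq0 // => /eqP.
Qed.

(** Substitution turns [fh(X) - f] into [fh(X) - fh(t)], which has the root
    [X = t]; a divisor of interest keeps that root. *)
Definition fiber_divisor (m : {poly {mpoly K[n]}}) : Prop :=
  [/\ m \is monic, (map_poly phi m).['X] = 0, forall i, integralOver rho m`_i &
      map_poly toF m %| map_poly (toF \o rho) (fiber_poly fh)].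

Lemma fiber_divisor_exists : exists m, fiber_divisor m.
Proof.
set Q := fiber_poly fh; have Uc := lead_coef_fiber_poly_unit fh_gt1.
have mon_Q : (lead_coef Q)^-1 *: Q \is monic by rewrite monicE lead_coefZ mulVr.
exists (map_poly rho ((lead_coef Q)^-1 *: Q)); split.
- by rewrite monic_map.
- rewrite -map_poly_comp map_polyZ hornerZ.
  have -> : map_poly (phi \o rho) Q = sepp fh.
    rewrite rmorphB /= map_polyC /= horner_algX; congr (_ - _).
    rewrite -map_poly_comp; apply: eq_map_poly => c /=.
    by rewrite horner_algC alg_mpolyC kronC.
  by rewrite hornerD hornerN hornerC -[_.['X]]/(fh \Po 'X) comp_polyXr subrr mulr0.
- by move=> i; rewrite coef_map; apply: integral_id.
- rewrite -map_poly_comp map_polyZ dvdpZl //=.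
  have Ui : (lead_coef Q)^-1 \is a GRing.unit by rewrite unitrV.
  have /= Ur := rmorph_unit rho Ui.
  by rewrite tofrac_eq0; apply: contraTneq Ur => ->; rewrite unitr0.
Qed.

(** A divisor of minimal degree among those vanishing at [t] is irreducible,
    so it divides [h(t)(X) - h] as soon as it shares a factor with it; and it
    shares one because the resultant is an integral element killed by the
    substitution, [X = t] being a common root. *)
Lemma minimal_fiber_divisor_dvd m : fiber_divisor m ->
    (forall m', fiber_divisor m' -> size m <= size m')%N ->
  forall h, integralOver rho h ->
    exists e, map_poly (@mpolyC n K) (phi h) - h%:P = m * e.
Proof.
move=> [mon_m mX0 int_m dv_m] min_m h int_h; set hh := phi h; set H := _ - _.
have int_mpolyC c : integralOver rho c%:MP.
  by rewrite -alg_mpolyC -(horner_algC f); apply: integral_id.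
have [hh_le1|hh_gt1] := leqP (size hh) 1.
  exists 0; rewrite mulr0 /H (size1_polyC hh_le1) map_polyC /= -polyCB.
  rewrite -[RHS]polyC0; congr _%:P; apply/eqP; rewrite subr_eq0 eq_sym -subr_eq0.
  apply/eqP/kron_integral_inj; first exact: integral_sub.
  by rewrite rmorphB /= kronC -(size1_polyC hh_le1) subrr.
have size_H : size H = size hh.
  have size_C : size (map_poly (@mpolyC n K) hh) = size hh.
    by rewrite size_map_inj_poly ?mpolyC0 //; exact: can_inj (@mpolyCK n K).
  by rewrite size_polyDl size_C // size_polyN (leq_ltn_trans (size_polyC_leq1 _)).
have mapH : map_poly phi H = sepp hh.
  rewrite rmorphB /= map_polyC /= -map_poly_comp; congr (_ - _).
  by apply: eq_map_poly => c /=; rewrite kronC.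
have m_gt1 : (1 < size m)%N.
  rewrite ltnNge; apply/negP => /size1_polyC Dm.
  move: mX0 (monicP mon_m); rewrite Dm map_polyC hornerC lead_coefC => m0 m1.
  by move: m0; rewrite m1 -mpolyC1 /= kronC => /eqP; rewrite polyC_eq0 oner_eq0.
have res0 : resultant m H = 0.
  apply: kron_integral_inj.
    apply: integral_resultant => // i; rewrite coefB coef_map coefC.
    apply: integral_sub; first exact: int_mpolyC.
    by case: (i == 0%N); [exact: int_h | exact: integral0].
  have [|[u v] /= _ Dres] := @resultant_in_ideal _ m H m_gt1.
    by rewrite size_H.
  have /(congr1 (fun p => (map_poly phi p).['X])) := Dres.
  rewrite map_polyC hornerC rmorphD !rmorphM /= hornerD !hornerM mX0 mapH => ->.
  rewrite /sepp hornerD hornerN hornerC -[_^:P.['X]]/(hh \Po 'X) comp_polyXr.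
  by rewrite subrr !mulr0 addr0.
have mF_neq0 : map_poly toF m != 0 by apply: monic_neq0; rewrite monic_map.
pose g := gcdp (map_poly toF m) (map_poly toF H).
have g_neq0 : g != 0 by rewrite gcdp_eq0 (negbTE mF_neq0).
have g_gt1 : (1 < size g)%N.
  move/eqP: res0; rewrite resultant_eq0; set d := gcdp m H => d_gt1.
  have size_d : size (map_poly toF d) = size d.
    by rewrite (size_map_inj_poly (@tofrac_inj _)) ?tofrac0.
  rewrite -size_d in d_gt1; apply: leq_trans d_gt1 _.
  apply: dvdp_leq => //; rewrite dvdp_gcd.
  have dvF p : d %| p -> map_poly toF d %| map_poly toF p.
    case/Pdiv.Idomain.dvdpP => [[c q] /= c_neq0 Dq].
    rewrite -(@dvdpZr _ (toF c)) ?tofrac_eq0 // -map_polyZ Dq rmorphM.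
    exact: dvdp_mulIr.
  by rewrite !dvF ?dvdp_gcdl ?dvdp_gcdr.
pose g0 := (lead_coef g)^-1 *: g.
have eq_g : g0 %= g by rewrite eqp_scale // invr_eq0 lead_coef_eq0.
have mon_g0 : g0 \is monic.
  by rewrite monicE lead_coefZ mulVf // lead_coef_eq0.
have dv_g0m : g0 %| map_poly toF m by rewrite (eqp_dvdl _ eq_g) dvdp_gcdl.
have /dvdpP[q0 Dq0] := dv_g0m.
have mon_q0 : q0 \is monic by rewrite -(monicMr _ mon_g0) -Dq0 monic_map.
have [g1 Dg1 int_g1] := monic_divisor_integral fh_gt1 mon_g0 (dvdp_trans dv_g0m dv_m).
have dv_q0m : q0 %| map_poly toF m by rewrite Dq0 dvdp_mulIl.
have [q1 Dq1 int_q1] := monic_divisor_integral fh_gt1 mon_q0 (dvdp_trans dv_q0m dv_m).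
have Dm : m = q1 * g1.
  by apply: (map_inj_poly (@tofrac_inj _) (tofrac0 _)); rewrite Dq0 Dq1 Dg1 rmorphM.
have mon_of p : map_poly toF p \is monic -> p \is monic.
  rewrite !monicE lead_coef_map_inj ?tofrac0 //; last exact: tofrac_inj.
  by rewrite -tofrac1 tofrac_eq.
have mon_g1 : g1 \is monic by apply: mon_of; rewrite -Dg1.
have mon_q1 : q1 \is monic by apply: mon_of; rewrite -Dq1.
have size_m : size m = (size q1 + size g1).-1 by rewrite Dm size_Mmonic ?monic_neq0.
have size_g1 : size g1 = size g.
  rewrite -(size_scale g (_ : (lead_coef g)^-1 != 0)) ?invr_eq0 ?lead_coef_eq0 //.
  by rewrite -/g0 Dg1 (size_map_inj_poly (@tofrac_inj _)) ?tofrac0.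
have /eqP : (map_poly phi q1).['X] * (map_poly phi g1).['X] = 0.
  by rewrite -hornerM -rmorphM -Dm.
rewrite mulf_eq0 => /orP[]/eqP root0.
  have fq : fiber_divisor q1.
    by split=> //; rewrite -Dq1; apply: dvdp_trans dv_q0m dv_m.
  have := min_m _ fq; rewrite size_m size_g1.
  case: (size g) g_gt1 => [|[|a]] // _; rewrite !addnS /= -{2}[size q1]addn0.
  by rewrite -addnS leq_add2l.
have fg : fiber_divisor g1.
  by split=> //; rewrite -Dg1; apply: dvdp_trans dv_g0m dv_m.
apply: monic_dvdp_frac => //.
have -> : m = g1; last by rewrite -Dg1 (eqp_dvdl _ eq_g) dvdp_gcdr.
have := min_m _ fg; rewrite size_m.
have : (0 < size q1)%N by rewrite size_poly_gt0 monic_neq0.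
case Dsq: (size q1) => [|[|a]] // _.
  by rewrite Dm; move/eqP: Dsq => /size_poly1P[c _ Dc]; move: mon_q1;
     rewrite Dc monicE lead_coefC => /eqP ->; rewrite mul1r.
by rewrite !addSn /= -addSn -{2}[size g1]add0n leq_add2r.
Qed.

End Closed.

Lemma noncomposite_closed (K : fieldType) (n : nat) (f : {mpoly K[n]}) :
  (0 < n)%N -> nonconstant f -> non_composite f -> closed_mpoly f.
Proof.
move=> n_gt0 nc_f ncomp_f; apply/closed_mpolyP => h int_h.
have [w [w_gt0 sepw _]] := kronecker_weights K (msize f) (Ordinal n_gt0).
have f_gt1 : (1 < msize f)%N.
  by rewrite ltnNge; apply/negP => /msize1_polyC; apply: nc_f.
have fh_gt1 := kron_size_gt1 sepw w_gt0 (leqnn _) f_gt1.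
have [m0 fd_m0] := fiber_divisor_exists fh_gt1.
have ex_size : exists s, `[< exists2 m, fiber_divisor f w m & size m = s >].
  by exists (size m0); apply/asboolP; exists m0.
have [s /asboolP[m fd_m Dsize] min_s] := ex_minnP ex_size.
have {}min_s m' : fiber_divisor f w m' -> (size m <= size m')%N.
  by move=> fd_m'; rewrite Dsize min_s //; apply/asboolP; exists m'.
have dvd_m := minimal_fiber_divisor_dvd fh_gt1 fd_m min_s.
have sepp_m x : integralOver (horner_alg f) x ->
    exists e, sepp (kron w x) = map_poly (@kron n w K) m * e.
  move=> /dvd_m[e De]; exists (map_poly (@kron n w K) e).
  rewrite -rmorphM -De rmorphB /= map_polyC /= -map_poly_comp.
  by congr (_ - _); apply: eq_map_poly => c /=; rewrite kronC.
case: fd_m => mon_m mX0 int_m _.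
have [||i Hi] := @luroth_generator K (map_poly (@kron n w K) m) _ mX0.
- by rewrite monic_map.
- by move=> i; rewrite coef_map; apply: sepp_m.
rewrite coef_map /= in Hi.
have gen x : integralOver (horner_alg f) x -> exists F, x = horner_alg m`_i F.
  move=> int_x; have [e De] := sepp_m x int_x; have [F DF] := Hi _ _ De.
  exists F; apply/eqP; rewrite -subr_eq0; apply/eqP.
  apply: (kron_integral_inj fh_gt1); last by rewrite rmorphB /= kron_horner -DF subrr.
  apply: integral_sub => //; apply: integral_horner; last exact: int_m.
  apply/integral_poly => j; rewrite coef_map /=.
  by rewrite -(horner_algC f); apply: integral_id.
have [F DF] : exists F, f = horner_alg m`_i F.
  by apply: gen; rewrite -[X in integralOver _ X](horner_algX f); apply: integral_id.
have [L DL] := degree1_generator DF (ncomp_f _ _ DF).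
have [G ->] := gen h int_h.
by exists (G \Po L); rewrite {1}DL horner_alg_comp.
Qed.

(** * Composition, generators and maximality *)

Section Generators.

Variables (K : fieldType) (n : nat).
Hypothesis n_gt0 : (0 < n)%N.
Implicit Types f g : {mpoly K[n]}.

Lemma nonconstant_msize f : nonconstant f -> (1 < msize f)%N.
Proof. by move=> nc_f; rewrite ltnNge; apply/negP => /msize1_polyC; apply: nc_f. Qed.

Lemma horner_alg_eq0 f q : nonconstant f -> horner_alg f q = 0 -> q = 0.
Proof.
move=> /nonconstant_msize f_gt1 qf0.
have [w [w_gt0 sepw _]] := kronecker_weights K (msize f) (Ordinal n_gt0).
have fh_gt1 := kron_size_gt1 sepw w_gt0 (leqnn _) f_gt1.
have /eqP := kron_horner w f q; rewrite qf0 raddf0 eq_sym.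
by rewrite comp_poly_eq0 // => /eqP.
Qed.

Lemma horner_alg_inj f : nonconstant f -> injective (horner_alg f).
Proof.
move=> nc_f p q eq_pq; apply/eqP; rewrite -subr_eq0; apply/eqP.
by apply: (horner_alg_eq0 nc_f); rewrite rmorphB /= eq_pq subrr.
Qed.

Lemma subalg_genP f h : subalg_gen f h <-> exists q, h = horner_alg f q.
Proof. by split=> [[q _ <-]|[q ->]]; exists q. Qed.

Lemma nonconstant_outer f g F : nonconstant f -> f = horner_alg g F ->
  (1 < size F)%N.
Proof.
move=> nc_f Df; rewrite ltnNge; apply/negP => /size1_polyC DF.
by apply: (nc_f F`_0); rewrite Df DF horner_algC alg_mpolyC coefC.
Qed.

Lemma nonconstant_inner f g F : nonconstant f -> f = horner_alg g F ->
  nonconstant g.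
Proof.
move=> nc_f Df c Dg; apply: (nc_f F.[c]); rewrite Df Dg -alg_mpolyC.
rewrite -(horner_algC (0 : {mpoly K[n]})) horner_alg_comp /comp_poly.
rewrite horner_map /= horner_algC alg_mpolyC //.
Qed.

(** If [f = F(g)] and [g] is a polynomial in [f], then [F] has degree [1]
    because [f] is transcendental. *)
Lemma generator_degree1 f g F L : nonconstant f ->
  f = horner_alg g F -> g = horner_alg f L -> size F = 2%N.
Proof.
move=> nc_f Df Dg; have F_gt1 := nonconstant_outer nc_f Df.
have FL : F \Po L = 'X.
  by apply: (horner_alg_inj nc_f); rewrite -horner_alg_comp -Dg -Df horner_algX.
have := congr1 (fun p : {poly K} => (size p).-1) FL.
rewrite /= size_polyX size_comp_poly /= => /eqP; rewrite muln_eq1 => /andP[/eqP F1 _].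
by rewrite -(prednK (ltnW F_gt1)) F1.
Qed.

Lemma noncomposite_maximal f : nonconstant f ->
  non_composite f <-> maximal_element (@one_generated_subalgs K n) (subalg_gen f).
Proof.
move=> nc_f; split=> [ncomp_f|[_ max_f] F g Df].
  split; first by exists f.
  move=> _ [g nc_g ->] sub_fg; apply/seteqP; split=> // h /subalg_genP[q ->].
  have /sub_fg/subalg_genP[F DF] : subalg_gen f f.
    by apply/subalg_genP; exists 'X; rewrite horner_algX.
  have [L DL] := degree1_generator DF (ncomp_f _ _ DF).
  by apply/subalg_genP; exists (q \Po L); rewrite {1}DL horner_alg_comp.
have nc_g := nonconstant_inner nc_f Df.
have : subalg_gen g = subalg_gen f.
  apply: max_f; first by exists g.
  move=> h /subalg_genP[q ->]; apply/subalg_genP; exists (q \Po F).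
  by rewrite {1}Df horner_alg_comp.
move=> Dgf; have : subalg_gen g g by apply/subalg_genP; exists 'X; rewrite horner_algX.
by rewrite Dgf => /subalg_genP[L DL]; apply: generator_degree1 nc_f Df DL.
Qed.

Lemma closed_noncomposite f : nonconstant f -> closed_mpoly f -> non_composite f.
Proof.
move=> nc_f /closed_mpolyP cl_f F g Df.
have F_gt1 := nonconstant_outer nc_f Df.
have [L DL] : exists L, g = horner_alg f L.
  apply/cl_f/(integral_unit_root (lead_coef_fiber_poly_unit F_gt1)).
  rewrite rmorphB /= map_polyC /= horner_algX -map_poly_comp /root.
  rewrite hornerD hornerN hornerC {2}Df subr_eq0; apply/eqP.
  rewrite [RHS]/horner_alg /= /horner_morph; congr (_.[_]).
  by apply: eq_map_poly => c /=; rewrite horner_algC.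
exact: generator_degree1 nc_f Df DL.
Qed.

End Generators.

(** * Perfect fields and partial derivatives *)

(** In an extension containing a [p]-th root [x] of [c], every factor of
    ['X^p - c] is a power of ['X - x]; a separable one is linear. *)
Lemma perfect_pth_root (K : fieldType) (p : nat) (c : K) :
  perfect_field K -> p \in [pchar K] -> exists b, b ^+ p = c.
Proof.
move=> perf charp; have p_gt0 : (0 < p)%N by apply/prime_gt0; case/andP: charp.
have [|q dv_q irr_q] := @irreducible_factor _ ('X^p - c%:P).
  by rewrite size_XnsubC.
have [E _ [x qx0 _]] := irredp_FAdjoin irr_q.
have charE : p \in [pchar {poly E}].
  by rewrite pchar_lalg pchar_lalg.
have dv_qE : map_poly (in_alg E) q %| map_poly (in_alg E) ('X^p - c%:P).
  by rewrite dvdp_map.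
have DxE : map_poly (in_alg E) ('X^p - c%:P) = ('X - x%:P) ^+ p.
  have root_x : root (map_poly (in_alg E) ('X^p - c%:P)) x.
    by have /dvdpP[s ->] := dv_qE; rewrite rootM qx0 orbT.
  move: root_x; rewrite rmorphB /= map_polyXn map_polyC /root hornerD hornerN hornerC.
  rewrite hornerXn subr_eq0 => /eqP <-.
  rewrite -!(pFrobenius_autE charE) pFrobenius_autB_comm; last exact: mulrC.
  by rewrite !pFrobenius_autE polyC_exp.
have [k le_kp Dq] : exists2 k, (k <= p)%N & map_poly (in_alg E) q %= ('X - x%:P) ^+ k.
  by apply/dvdp_exp_XsubCP; rewrite -DxE.
have q_gt1 : (1 < size q)%N by case: irr_q.
have size_q : size q = k.+1.
  by rewrite -(size_map_poly (in_alg E)) (eqp_size Dq) size_exp_XsubC.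
have sep_q : separable_poly (map_poly (in_alg E) q).
  by rewrite separable_map; apply: perf.
have k1 : k = 1%N.
  have k_gt0 : (0 < k)%N by rewrite -ltnS -size_q.
  apply/eqP; rewrite eqn_leq k_gt0 andbT leqNgt; apply/negP => k_gt1.
  have := @separable_nosquare _ _ ('X - x%:P) k sep_q k_gt1.
  by rewrite size_XsubC /= (eqp_dvdr _ Dq) dvdpp => /(_ isT).
have [b qb0] : {b | root q b} by apply: poly2_root; rewrite size_q k1.
exists b; have /dvdpP[s Ds] := dv_q.
have : root ('X^p - c%:P) b by rewrite Ds rootM qb0 orbT.
by rewrite /root hornerD hornerN hornerC hornerXn subr_eq0 => /eqP.
Qed.

Lemma pchar_mpoly (K : fieldType) (n : nat) : [pchar {mpoly K[n]}] =i [pchar K].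
Proof. exact: pchar_lalg. Qed.

(** In characteristic [p], if all partial derivatives of [f] vanish then [f] is
    a polynomial in the [X_i^p], hence a [p]-th power as [K] is perfect. *)
Lemma noncomposite_partial_neq0 (K : fieldType) (n : nat) (f : {mpoly K[n]}) :
    perfect_field K -> nonconstant f -> non_composite f ->
  exists i, f^`M(i) != 0.
Proof.
move=> perf nc_f ncomp_f; apply/not_existsP => all0.
have {}all0 (m : 'X_{1..n}) i : m \in msupp f -> (m i)%:R = 0 :> K.
  rewrite mcoeff_msupp => fm_neq0; have [-> //|mi_neq0] := eqVneq (m i) 0%N.
  have Dm : (m - U_(i) + U_(i))%MM = m.
    by rewrite submK // lep1mP.
  have /eqP : (f^`M(i))@_(m - U_(i)) = 0.
    by have /negP/negPn/eqP -> := all0 i; rewrite mcoeff0.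
  rewrite mcoeff_deriv Dm mnmBE mnm1E eqxx subn1 prednK ?lt0n //.
  by rewrite -[f@_m *+ _]mulr_natr mulf_eq0 (negbTE fm_neq0) => /eqP.
have [[p charp]|nochar] := pselect (exists p, p \in [pchar K]); last first.
  have f_gt1 := nonconstant_msize nc_f.
  have f_neq0 : f != 0 by rewrite -msize_poly_eq0 -lt0n ltnW.
  have := mlead_deg f_neq0; have -> : mlead f = 0%MM.
    apply/mnmP => i; rewrite mnm0E; apply/eqP.
    rewrite -(pcharf0P K).1 ?all0 ?mlead_supp // => p.
    by apply/negbTE/negP => charp; apply: nochar; exists p.
  by rewrite mdeg0 => D1; rewrite -D1 in f_gt1.
have /choice[b Db] c := perfect_pth_root c perf charp.
have p_pr : prime p by case/andP: charp.
have charM : p \in [pchar {mpoly K[n]}] by rewrite pchar_mpoly.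
pose root_mnm (m : 'X_{1..n}) := [multinom (m i %/ p)%N | i < n].
pose g := \sum_(m <- msupp f) b f@_m *: 'X_[root_mnm m] : {mpoly K[n]}.
have Df : f = g ^+ p.
  rewrite -(pFrobenius_autE charM) rmorph_sum /= [LHS]mpolyE.
  rewrite !big_seq; apply: eq_bigr => m f_m.
  rewrite pFrobenius_autE exprZn Db mpolyXn; congr (_ *: 'X_[_]).
  apply/mnmP => i; rewrite mulmnE mnmE divnK // (dvdn_pcharf charp).
  by apply/eqP/all0.
have := ncomp_f 'X^p g; rewrite rmorphXn /= horner_algX size_polyXn => /(_ Df).
by move=> [p1]; move: p_pr; rewrite p1.
Qed.

(** * Factorizations and subsets of roots *)

Section Defect.

Variables (n : nat) (w : 'I_n -> nat) (B d : nat).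

Definition rootpoly (R : comNzRingType) (v : 'I_d -> R) (S : {set 'I_d}) : {poly R} :=
  \prod_(i in S) ('X - (v i)%:P).

(** If the Kronecker image of [p] has the roots [v i], a factorization of [p]
    gives a set [S] of zero defect, the set of roots of one of the factors. *)
Definition defect (R : comNzRingType) (v : 'I_d -> R) (S : {set 'I_d}) : {mpoly R[n]} :=
  dekron w B (rootpoly v S) * dekron w B (rootpoly v (~: S))
  - dekron w B (rootpoly v finset.setT).

Definition proper_part (S : {set 'I_d}) : bool := (S != finset.set0) && (S != finset.setT).

Definition total_defect (R : comNzRingType) (v : 'I_d -> R) : {mpoly R[n]} :=
  \prod_(S | proper_part S) defect v S.

Lemma rootpoly_map (R R' : comNzRingType) (g : {rmorphism R -> R'}) v S :
  map_poly g (rootpoly v S) = rootpoly (g \o v) S.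
Proof.
rewrite rmorph_prod; apply: eq_bigr => i _.
by rewrite rmorphB /= map_polyX map_polyC.
Qed.

Lemma total_defect_map (R R' : comNzRingType) (g : {rmorphism R -> R'}) v :
  map_mpoly g (total_defect v) = total_defect (g \o v).
Proof.
rewrite rmorph_prod; apply: eq_bigr => S _.
by rewrite rmorphB rmorphM /= -!dekron_map !rootpoly_map.
Qed.

Lemma eq_rootpoly (R : comNzRingType) (v v' : 'I_d -> R) S :
  v =1 v' -> rootpoly v S = rootpoly v' S.
Proof. by move=> eq_v; apply: eq_bigr => i _; rewrite eq_v. Qed.

Lemma eq_total_defect (R : comNzRingType) (v v' : 'I_d -> R) :
  v =1 v' -> total_defect v = total_defect v'.
Proof.
move=> eq_v; apply: eq_bigr => S _.
by rewrite /defect !(eq_rootpoly _ eq_v).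
Qed.

Lemma rootpoly_perm (R : comNzRingType) (v : 'I_d -> R) (s : 'S_d) S :
  rootpoly (v \o s) S = rootpoly v (s @: S).
Proof. by rewrite /rootpoly big_imset //= => x y _ _; apply: perm_inj. Qed.

Lemma total_defect_perm (R : comNzRingType) (v : 'I_d -> R) (s : 'S_d) :
  total_defect (v \o s) = total_defect v.
Proof.
have imC (S : {set 'I_d}) : s @: (~: S) = ~: (s @: S).
  by rewrite !imset_set1 || (apply/setP => i; rewrite inE -{1 2}(permKV s i)
    !(mem_imset _ _ (@perm_inj _ s)) inE).
have imT : s @: finset.setT = finset.setT.
  apply/setP => i; rewrite inE -(permKV s i).
  by rewrite (mem_imset _ _ (@perm_inj _ s)) inE.
have im_inj : injective (fun S : {set 'I_d} => s @: S).
  exact/imset_inj/perm_inj.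
rewrite [RHS](reindex_inj im_inj); apply: eq_big => [S|S _].
  rewrite /proper_part imset_eq0; congr (_ && ~~ _).
  by rewrite -{2}imT (inj_eq im_inj).
by rewrite /defect !rootpoly_perm imC imT.
Qed.

Lemma total_defect_symmetric (R : comNzRingType) (m : 'X_{1..n}) :
  (total_defect (fun i : 'I_d => 'X_i : {mpoly R[d]}))@_m \is symmetric.
Proof.
apply/issymP => s; pose X (i : 'I_d) : {mpoly R[d]} := 'X_i.
have DX : msym s \o X =1 X \o s.
  move=> i /=; rewrite /X msymX; congr 'X_[_].
  apply/mnmP => j; rewrite mnmE !mnm1E; congr (nat_of_bool _).
  by apply/eqP/eqP => [->|<-]; rewrite ?permKV ?permK.
have Ds : total_defect (msym s \o X) = total_defect X.
  by rewrite (eq_total_defect DX) total_defect_perm.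
by rewrite -/X -{2}Ds -total_defect_map mcoeff_map_mpoly.
Qed.

End Defect.

Lemma mmap_comp (R S : comNzRingType) (rho : {rmorphism R -> S}) (k l : nat)
    (h : 'I_l -> S) (lq : k.-tuple {mpoly R[l]}) (p : {mpoly R[k]}) :
  mmap rho h (p \mPo lq) = mmap rho (fun i => mmap rho h (tnth lq i)) p.
Proof.
elim/mpolyind: p => [|c m p _ _ IHp]; first by rewrite !raddf0.
rewrite !raddfD /= IHp; congr (_ + _).
rewrite comp_mpolyZ !mmapZ comp_mpolyX mmapX /mmap1 rmorph_prod; congr (_ * _).
by apply: eq_bigr => i _; rewrite rmorphXn.
Qed.

Lemma mmap_mesym (R S : comNzRingType) (rho : {rmorphism R -> S}) (d k : nat)
    (v : 'I_d -> S) :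
  mmap rho v (mesym d R k) = (mesym d S k).@[v].
Proof.
rewrite !mesymE !raddf_sum /=; apply: eq_bigr => S' _.
by rewrite mmapX mevalX.
Qed.

(** The coefficients of the total defect are symmetric in the roots, so they
    depend polynomially on the coefficients of the polynomial that has these
    roots, uniformly in the ring that contains them. *)
Lemma total_defect_coef (n : nat) (w : 'I_n -> nat) (B d : nat) (A : idomainType)
    (P : {poly A}) (m : 'X_{1..n}) :
    size P = d.+1 -> lead_coef P \is a GRing.unit ->
  exists q : A, forall (R : idomainType) (sigma : {rmorphism A -> R}) (v : 'I_d -> R),
    map_poly sigma P = sigma (lead_coef P) *: rootpoly v finset.setT ->
    (total_defect w B v)@_m = sigma q.
Proof.
move=> size_P Uc; have [G [DG _]] := sym_fundamental (total_defect_symmetric w B d A m).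
(* The elementary symmetric functions of the roots, read off [P]. *)
pose e (i : 'I_d) : A := (-1) ^+ i.+1 * ((lead_coef P)^-1 * P`_(d - i.+1)).
exists (G.@[e]) => R sigma v Dv.
have -> : total_defect w B v = map_mpoly (mmap sigma v)
    (total_defect w B (fun i : 'I_d => 'X_i : {mpoly A[d]})).
  rewrite total_defect_map; apply: eq_total_defect => i /=.
  by rewrite mmapX mmap1U.
rewrite mcoeff_map_mpoly -DG /= mmap_comp /meval.
rewrite /mmap rmorph_sum; apply: eq_bigr => mu _; rewrite rmorphM /=; congr (_ * _).
rewrite /mmap1 rmorph_prod; apply: eq_bigr => i _; rewrite rmorphXn; congr (_ ^+ _).
rewrite tnth_mktuple -/(mmap sigma v _) mmap_mesym.
have lt_id : (i.+1 < d.+1)%N by rewrite ltnS.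
have := mroots_coeff [tuple v i | i < d] (Ordinal lt_id).
rewrite big_tuple /=; under eq_bigr do rewrite tnth_mktuple.
have -> : \prod_(i0 < d) ('X - (v i0)%:P) = rootpoly v finset.setT.
  by rewrite /rootpoly; apply: eq_bigl => j; rewrite inE.
have Dcoef j : (rootpoly v finset.setT)`_j = sigma ((lead_coef P)^-1 * P`_j).
  rewrite rmorphM -coef_map Dv coefZ mulrA -rmorphM mulVr //.
  by rewrite rmorph1 mul1r.
rewrite Dcoef /e => Dmesym.
have signE x : sigma ((-1) ^+ i.+1 * x) = (-1) ^+ i.+1 * sigma x.
  by rewrite rmorphM rmorphXn rmorphN1.
rewrite signE Dmesym.
rewrite mulrA -exprD addnn -mul2n exprM sqrrN expr1n expr1n mul1r.
by apply: meval_eq => j; rewrite tnth_mktuple.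
Qed.

(** * The generic fiber *)

Lemma adjoin_seq_ind (F : fieldType) (E : fieldExtType F) (P : E -> Prop)
    (rs : seq E) :
    (forall a : F, P a%:A) -> (forall x y, P x -> P y -> P (x + y)) ->
    (forall x y, P x -> P y -> P (x * y)) -> (forall x, x \in rs -> P x) ->
  forall y, y \in <<1 & rs>>%VS -> P y.
Proof.
move=> Pbase Padd Pmul; elim/last_ind: rs => [|rs r IHrs] Prs y.
  by rewrite adjoin_nil subfield_closed => /vlineP[a ->].
rewrite adjoin_rcons => /Fadjoin_polyP[p /polyOverP p_over ->].
have {}IHrs x : x \in <<1 & rs>>%VS -> P x.
  by apply: IHrs => z rs_z; apply: Prs; rewrite mem_rcons inE rs_z orbT.
have Pr : P r by apply: Prs; rewrite mem_rcons mem_head.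
have P0 : P 0 by have := Pbase 0; rewrite scale0r.
have Pexp k : P (r ^+ k).
  elim: k => [|k IHk]; last by rewrite exprS; apply: (Pmul _ _ Pr IHk).
  by have := Pbase 1; rewrite scale1r.
by rewrite horner_coef; apply: (big_ind P) => // i _; apply: Pmul => //; apply: IHrs.
Qed.

(** Powers of [t] below the degree of [u] are independent over [K[u(t)]]: the
    degrees of the terms are pairwise distinct modulo that of [u]. *)
Lemma comp_poly_free (K : fieldType) (J : finType) (u : {poly K}) (e : J -> nat)
    (q : J -> {poly K}) :
    injective e -> (forall j, q j != 0 -> (e j < (size u).-1)%N) ->
  \sum_j (q j \Po u) * 'X^(e j) = 0 -> forall j, q j = 0.
Proof.
move=> e_inj e_lt sum0 j; apply/eqP/idPn => qj_neq0.
have u_gt0 : (0 < (size u).-1)%N by apply: leq_ltn_trans (e_lt j qj_neq0).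
have u_gt1 : (1 < size u)%N by case: (size u) u_gt0 => [|[|]].
pose N i := ((size (q i)).-1 * (size u).-1 + e i)%N.
have size_term i : q i != 0 -> size ((q i \Po u) * 'X^(e i)) = (N i).+1.
  move=> qi_neq0; rewrite size_mulXn ?comp_poly_eq0 //.
  have : q i \Po u != 0 by rewrite comp_poly_eq0.
  rewrite -size_poly_gt0 => /prednK <-.
  by rewrite size_comp_poly addnS addnC.
case: (@arg_maxnP _ j (fun i => q i != 0) N qj_neq0) => i qi_neq0 max_i.
have := congr1 (fun p : {poly K} => p`_(N i)) sum0.
rewrite coef0 coef_sum (bigD1 i) //= big1 ?addr0 => [|k k_neq_i].
  have := size_term i qi_neq0 => size_i.
  move/eqP; rewrite -[N i]/((N i).+1.-1) -size_i -/(lead_coef _) lead_coef_eq0.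
  by rewrite -size_poly_eq0 size_i.
have [qk0|qk_neq0] := eqVneq (q k) 0; first by rewrite qk0 comp_poly0 mul0r coef0.
rewrite nth_default // size_term // ltn_neqAle (max_i k qk_neq0 : N k <= N i)%N andbT.
apply: contraNneq k_neq_i => eq_N; apply/eqP/e_inj.
have /(congr1 (fun x => x %% (size u).-1)%N) := eq_N.
by rewrite /N !modnMDl !modn_small ?e_lt.
Qed.

Lemma dekron_fiber (K : fieldType) (n : nat) (w : 'I_n -> nat) (f : {mpoly K[n]})
    (R : comNzRingType) (sigma : {rmorphism {poly K} -> R}) :
    separates_monomials w (msize f) -> nonconstant f ->
  dekron w (msize f) (map_poly sigma (fiber_poly (kron w f))) =
    map_mpoly (sigma \o polyC) f - (sigma 'X)%:MP.
Proof.
move=> sep_w /nonconstant_msize f_gt1.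
rewrite rmorphB /= map_polyC /= -map_poly_comp /=.
have dekronB (P Q : {poly R}) : dekron w (msize f) (P - Q) =
    dekron w (msize f) P - dekron w (msize f) Q.
  apply/mpolyP => m; rewrite mcoeffB !mcoeff_dekron coefB.
  by case: ifP => // _; rewrite subr0.
rewrite dekronB (dekron_map w (sigma \o polyC)) kronK //; congr (_ - _).
have weight0 : weight w 0%MM = 0%N.
  by rewrite /weight big1 // => i _; rewrite mnm0E.
apply/mpolyP => m; rewrite mcoeffC mcoeff_dekron coefC.
have [->|m_neq0] := eqVneq m 0%MM.
  by rewrite mdeg0 weight0 (ltnW f_gt1) eqxx mulr1.
rewrite mulr0; case: ltnP => // lt_m; case: eqP => // wm0.
by case/eqP: m_neq0; apply: sep_w; rewrite ?mdeg0 ?(ltnW f_gt1) ?wm0 ?weight0.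
Qed.

Section GenericFiber.

Variables (K : fieldType) (n : nat) (f : {mpoly K[n]}) (w : 'I_n -> nat).
Local Notation M0 := {fraction {mpoly K[n]}}.
Variables (E : splittingFieldType M0) (d : nat) (v : 'I_d -> E).

Local Notation rho := (horner_alg f : {rmorphism {poly K} -> {mpoly K[n]}}).
Local Notation toF := (@FracField.tofrac {mpoly K[n]}).
Local Notation incl := (in_alg E \o toF : {rmorphism {mpoly K[n]} -> E}).
Local Notation sigma := (in_alg E \o toF \o rho : {rmorphism {poly K} -> E}).
Local Notation B := (msize f).
Local Notation fh := (kron w f).

Hypothesis n_gt0 : (0 < n)%N.
Hypothesis nc_f : nonconstant f.
Hypothesis closed_f : closed_mpoly f.
Hypothesis w_gt0 : forall i, (0 < w i)%N.
Hypothesis sep_w : separates_monomials w B.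
Hypothesis deriv_fh : fh^`() != 0.
Hypothesis size_fh : size fh = d.+1.
Hypothesis roots_v :
  map_poly sigma (fiber_poly fh) =
    sigma (lead_coef (fiber_poly fh)) *: rootpoly v finset.setT.
Hypothesis gen_v : <<1 & codom v>>%VS = {:E}%VS.

Lemma generic_fh_gt1 : (1 < size fh)%N.
Proof. exact: (kron_size_gt1 sep_w w_gt0 (leqnn _) (nonconstant_msize nc_f)). Qed.

Lemma incl_inj : injective incl.
Proof.
by move=> x y /= /(fmorph_inj (in_alg E)) /tofrac_inj.
Qed.

Lemma sigma_inj : injective sigma.
Proof.
by move=> x y /= /(fmorph_inj (in_alg E)) /tofrac_inj; apply: horner_alg_inj.
Qed.

Lemma integral_generic_root i : integralOver sigma (v i).
Proof.
apply: (integral_unit_root (lead_coef_fiber_poly_unit generic_fh_gt1)).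
rewrite roots_v /root hornerZ /rootpoly (bigD1 i) ?inE //= hornerM hornerXsubC.
by rewrite subrr mul0r mulr0.
Qed.

(** Polynomial rings are integrally closed and [f] is closed, so that integral
    elements of the base field are polynomials in [f]. *)
Lemma integral_generic_descent (a : M0) :
  integralOver sigma (in_alg E a) -> exists q, in_alg E a = sigma q.
Proof.
move=> int_a; have : integralOver (toF \o rho) a.
  apply: (@integral_descent _ _ _ (toF \o rho) (in_alg E)); last exact: int_a.
  exact: fmorph_inj.
case/integral_frac => h -> int_h.
by have /closed_mpolyP/(_ h int_h)[q ->] := closed_f; exists q.
Qed.

Local Notation iotaK := (sigma \o polyC : {rmorphism K -> E}).

(** A common root of [fh(X) - f] and [fh'(X)] would be algebraic over [K], and
    then so would [f]. *)
Lemma generic_separable : separable_poly (map_poly sigma (fiber_poly fh)).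
Proof.
rewrite separable_poly.unlock.
have Dder : (map_poly sigma (fiber_poly fh))^`() = map_poly iotaK fh^`().
  by rewrite deriv_map derivB derivC subr0 deriv_map -map_poly_comp.
have lead_neq0 : sigma (lead_coef (fiber_poly fh)) != 0.
  have := rmorph_unit sigma (lead_coef_fiber_poly_unit generic_fh_gt1).
  by rewrite unitfE.
rewrite Dder roots_v coprimepZl // /rootpoly.
apply: (big_ind (fun p => coprimep p (map_poly iotaK fh^`()))) => [|p q cop cop'|i _].
- exact: coprime1p.
- by rewrite coprimepMl cop.
rewrite coprimep_sym coprimep_XsubC; apply/negP => root_vi.
have int_vi : integralOver iotaK (v i).
  by apply/integral_algebraic; exists fh^`().
have DX : sigma 'X = (map_poly iotaK fh).[v i].
  apply/eqP; rewrite eq_sym -subr_eq0.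
  have : root (map_poly sigma (fiber_poly fh)) (v i).
    rewrite roots_v /root hornerZ /rootpoly (bigD1 i) ?inE //= hornerM hornerXsubC.
    by rewrite subrr mul0r mulr0.
  by rewrite /root rmorphB /= map_polyC /= -map_poly_comp hornerD hornerN hornerC.
have /integral_algebraic[p p_neq0] : integralOver iotaK (sigma 'X).
  rewrite DX; apply: integral_horner => //; apply/integral_poly => j.
  by rewrite coef_map; apply: integral_id.
rewrite map_poly_comp /root.
have -> : (map_poly sigma (map_poly polyC p)).[sigma 'X] = sigma p.
  by rewrite horner_map -[p^:P.['X]]/(p \Po 'X) comp_polyXr.
rewrite -(rmorph0 sigma) => /eqP/sigma_inj p0.
by rewrite p0 eqxx in p_neq0.
Qed.

Lemma generic_galois : galois 1 {:E}%AS.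
Proof.
apply/splitting_galoisField; exists (map_poly sigma (fiber_poly fh)); split.
- by apply/polyOverP => i; rewrite coef_map /= rpredZ ?mem1v.
- exact: generic_separable.
exists (codom v); last exact: gen_v.
have lead_neq0 : sigma (lead_coef (fiber_poly fh)) != 0.
  have := rmorph_unit sigma (lead_coef_fiber_poly_unit generic_fh_gt1).
  by rewrite unitfE.
rewrite roots_v (eqp_trans (eqp_scale _ lead_neq0)) // /codom big_map big_enum /=.
by rewrite /rootpoly; under eq_bigl do rewrite inE; exact: eqpxx.
Qed.

Local Notation Tr := (galTrace 1 {:E}).

Lemma gal_fix_base (g : gal_of {:E}) (a : M0) : g a%:A = a%:A.
Proof. by rewrite linearZ /= rmorph1. Qed.

Lemma galTrace_base (a : M0) y : Tr (a%:A * y) = a%:A * Tr y.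
Proof.
rewrite /galTrace mulr_sumr; apply: eq_bigr => g _.
by rewrite rmorphM /= gal_fix_base.
Qed.

(** Conjugates of integral elements are integral, as [sigma] takes its values in
    the base field. *)
Lemma integral_galTrace y : integralOver sigma y -> exists q, Tr y = sigma q.
Proof.
move=> int_y; have /vlineP[a Da] := mem_galTrace generic_galois (memvf y).
rewrite Da; apply: integral_generic_descent; rewrite /= -Da.
apply: integral_sum => g _; case: int_y => p mon_p py0; exists p => //.
have -> : map_poly sigma p = map_poly g (map_poly sigma p).
  by rewrite -map_poly_comp; apply: eq_map_poly => c /=; rewrite gal_fix_base.
by rewrite rmorph_root.
Qed.

Definition generic_point (i : 'I_n) : E := incl 'X_i.

Lemma meval_generic_point (h : {mpoly K[n]}) :
  (map_mpoly iotaK h).@[generic_point] = incl h.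
Proof.
have DX m : 'X_[m].@[generic_point] = incl 'X_[m].
  rewrite mevalX mpolyXE_id (rmorph_prod incl); apply: eq_bigr => i _.
  by rewrite (rmorphXn incl).
have DC c : iotaK c = incl c%:MP by rewrite /= horner_algC alg_mpolyC.
have DZ c p : incl (c *: p) = iotaK c * incl p.
  by rewrite DC -(rmorphM incl) mul_mpolyC.
elim/mpolyind: h => [|c m p _ _ IHp]; first by rewrite !raddf0.
transitivity (iotaK c * incl 'X_[m] + incl p); last by rewrite -DZ -raddfD.
rewrite -IHp -DX -mevalZ -mevalD; congr (_.@[_]).
by rewrite rmorphD /= map_mpolyZ map_mpolyX.
Qed.

Lemma meval_dekron (P : {poly E}) :
  (dekron w B P).@[generic_point] =
  \sum_(m : 'X_{1..n < B}) P`_(weight w m) * incl 'X_[m].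
Proof.
rewrite /dekron (raddf_sum (meval generic_point)) /=.
apply: eq_bigr => m _; rewrite mevalZ; congr (_ * _).
by have := meval_generic_point 'X_[m]; rewrite map_mpolyX.
Qed.

(** If the polynomial with roots [v i], [i \in S], decodes to a polynomial
    vanishing at the generic point, the traces of its coefficients, multiplied
    by any integral [c], are the [sigma (q m)] of a relation
    [\sum_m (q m)(f) * X^m = 0]. Only monomials of weight less than the degree
    of [fh] occur in it, so it is trivial. As the integral elements span [E]
    over its base field, the trace form then kills all the coefficients. *)
Lemma generic_part_eq0 (S : {set 'I_d}) : S != finset.setT ->
    (dekron w B (rootpoly v S)).@[generic_point] = 0 ->
  dekron w B (rootpoly v S) = 0.
Proof.
move=> S_neqT; rewrite meval_dekron; set P := rootpoly v S => P0.
have size_P : (size P <= d)%N.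
  rewrite /P /rootpoly -big_enum size_prod_XsubC -cardE.
  rewrite -[leqRHS]card_ord -cardsT proper_card //.
  by rewrite finset.properEneq S_neqT finset.subsetT.
have int_P j : integralOver sigma P`_j.
  rewrite /P /rootpoly -big_enum; apply: integral_coef_prod_XsubC => i _.
  exact: integral_generic_root.
have int_trace c : integralOver sigma c ->
    forall m : 'X_{1..n < B}, Tr (c * P`_(weight w m)) = 0.
  move=> int_c.
  have /choice[q Dq] (m : 'X_{1..n < B}) :
      exists qm, Tr (c * P`_(weight w m)) = sigma qm.
    by apply/integral_galTrace/integral_mul.
  have sum0 : \sum_m horner_alg f (q m) * 'X_[bmnm m] = 0.
    have Dsum : \sum_(m : 'X_{1..n < B}) Tr (c * (P`_(weight w m) * incl 'X_[m])) = 0.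
      by rewrite -raddf_sum -mulr_sumr P0 mulr0 raddf0.
    apply: incl_inj; rewrite (rmorph_sum incl) raddf0 -[RHS]Dsum.
    apply: eq_bigr => m _.
    rewrite mulrA [c * _ * _]mulrC [incl _]/(_%:A) galTrace_base Dq.
    by rewrite [LHS](rmorphM incl) mulrC.
  have q0 := @comp_poly_free K _ fh (fun m : 'X_{1..n < B} => weight w m) q.
  move=> m; rewrite Dq q0 ?raddf0 //.
  - move=> m1 m2 eq_m; apply: val_inj; apply: sep_w => //; exact: bmdeg.
  - move=> m' qm'_neq0; rewrite size_fh ltnNge; apply: contra qm'_neq0 => le_d.
    apply/eqP/sigma_inj; rewrite -Dq nth_default ?(leq_trans size_P) //.
    by rewrite mulr0 !raddf0.
  - have := congr1 (kron w (R := K)) sum0; rewrite raddf0 (raddf_sum (@kron n w K)) => sum0'.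
    rewrite -[RHS]sum0'; apply: eq_bigr => m' _.
    by rewrite [RHS](rmorphM (@kron n w K)) /= kron_horner kronX.
have trace0 (m : 'X_{1..n < B}) y : Tr (y * P`_(weight w m)) = 0.
  (* The elements [y] with [y * W] inside [W] form a subalgebra that contains
     the roots, hence everything. *)
  pose W z := forall c, integralOver sigma c -> Tr (c * z * P`_(weight w m)) = 0.
  have W1 : W 1 by move=> c int_c; rewrite mulr1 int_trace.
  suffices : W (y * 1) by move=> /(_ 1 (integral1 _)); rewrite mul1r mulr1.
  have : y \in <<1 & codom v>>%VS by rewrite gen_v memvf.
  move: y {P0}; suffices stable y : y \in <<1 & codom v>>%VS -> forall z, W z -> W (y * z).
    by move=> y /stable; apply.
  move: y; apply: adjoin_seq_ind => [a z Wz c int_c|x y Hx Hy z Wz c int_c|x y Hx Hy z Wz|x].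
  - by rewrite mulrCA -!mulrA galTrace_base mulrA Wz // mulr0.
  - by rewrite mulrDl mulrDr mulrDl raddfD /= (Hx z Wz c int_c) (Hy z Wz c int_c) addr0.
  - by rewrite -mulrA; apply/Hx/Hy.
  - case/codomP => i -> z Wz c int_c; rewrite [c * _]mulrA; apply: Wz.
    exact/integral_mul/integral_generic_root.
have P_eq0 (m : 'X_{1..n < B}) : P`_(weight w m) = 0.
  have indep y : y \in {:E}%AS ->
      \sum_(g in 'Gal({:E} / 1)%g) g P`_(weight w m) * g y = 0.
    move=> _; rewrite -[RHS](trace0 m y); apply: eq_bigr => g _.
    by rewrite rmorphM mulrC.
  have := gal_independent indep (group1 ('Gal({:E} / 1)%G)).
  by rewrite gal_id.
by rewrite /dekron big1 // => m _; rewrite P_eq0 scale0r.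
Qed.

(** For a set [S] of zero defect, the two decoded factors have the product
    [(f - f(x)) / c] with [c] the leading coefficient of [fh], which vanishes
    at [x]; so one of them vanishes at [x], hence identically, although the
    product is nonzero. *)
Lemma generic_total_defect_neq0 : total_defect w B v != 0.
Proof.
apply/prodf_neq0 => S /andP[S_neq0 S_neqT]; apply/negP; rewrite /defect subr_eq0.
set a := dekron w B (rootpoly v S); set b := dekron w B _; set c := dekron w B _.
move=> /eqP Dab.
have Dc : sigma (lead_coef (fiber_poly fh)) *: c =
    map_mpoly iotaK f - (sigma 'X)%:MP.
  by rewrite -(dekron_fiber _ sep_w nc_f) roots_v dekronZ.
have : a.@[generic_point] * b.@[generic_point] = 0.
  have lead_neq0 : sigma (lead_coef (fiber_poly fh)) != 0.
    have := rmorph_unit sigma (lead_coef_fiber_poly_unit generic_fh_gt1).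
    by rewrite unitfE.
  apply: (mulfI lead_neq0); rewrite mulr0 -mevalM Dab -mevalZ Dc mevalB mevalC.
  by rewrite meval_generic_point /= horner_algX subrr.
move/eqP; rewrite mulf_eq0 => ab0.
have c0 : c = 0.
  rewrite -Dab; case/orP: ab0 => /eqP eval0.
    by rewrite /a (generic_part_eq0 S_neqT eval0) mul0r.
  have SC_neqT : ~: S != finset.setT.
    by apply: contraNneq S_neq0 => ST; rewrite -[S]finset.setCK ST finset.setCT.
  by rewrite /b (generic_part_eq0 SC_neqT eval0) mulr0.
suff Df : f = (f@_0%MM)%:MP by exact: nc_f Df.
apply/mpolyP => m; rewrite mcoeffC.
have [->|m_neq0] := eqVneq m 0%MM; first by rewrite mulr1.
rewrite mulr0; apply: (fmorph_inj iotaK); rewrite raddf0 -mcoeff_map_mpoly.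
move/eqP: Dc; rewrite c0 scaler0 eq_sym subr_eq0 => /eqP ->.
by rewrite mcoeffC (negbTE m_neq0) mulr0.
Qed.

End GenericFiber.

(** * Irreducibility of the fibers *)

Lemma mpoly_unitE (F : fieldType) (n : nat) (a : {mpoly F[n]}) :
  (a \is a GRing.unit) = (msize a == 1%N).
Proof.
apply/idP/msize_poly1P => [/andP[/eqP Da Ua]|[c c_neq0 ->]].
  by exists a@_0%MM => //; rewrite -unitfE.
by apply/andP; rewrite mcoeffC eqxx mulr1 unitfE.
Qed.

(** A factorization distributes the roots among the two factors. *)
Lemma irreducible_of_total_defect (F : fieldType) (n : nat) (w : 'I_n -> nat)
    (B d : nat) (v : 'I_d -> F) (p : {mpoly F[n]}) (c : F) :
    (forall i, 0 < w i)%N -> separates_monomials w B ->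
    (1 < msize p <= B)%N -> c != 0 -> kron w p = c *: rootpoly v finset.setT ->
  total_defect w B v != 0 -> irreducible_element p.
Proof.
move=> w_gt0 sep_w /andP[p_gt1 le_pB] c_neq0 Dkp /prodf_neq0 defect_neq0.
have p_neq0 : p != 0 by rewrite -msize_poly_eq0 -lt0n ltnW.
split=> // [|a b Dp]; first by rewrite mpoly_unitE gtn_eqF.
rewrite !mpoly_unitE; apply/orP; apply: contraT => /norP[a_neq1 b_neq1].
have /andP[a_neq0 b_neq0] : (a != 0) && (b != 0) by rewrite -negb_or -mulf_eq0 -Dp.
have gt1 (x : {mpoly F[n]}) : x != 0 -> msize x != 1%N -> (1 < msize x)%N.
  by rewrite -msize_poly_eq0; case: (msize x) => [|[|]].
have [a_gt1 b_gt1] := (gt1 a a_neq0 a_neq1, gt1 b b_neq0 b_neq1).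
have size_p : msize p = (msize a + msize b).-1 by rewrite Dp msizeM.
have [le_aB le_bB] : (msize a <= B)%N /\ (msize b <= B)%N.
  move: le_pB; rewrite size_p; move: (msize a) (msize b) a_gt1 b_gt1 => s t.
  by lia.
have ka_gt1 := kron_size_gt1 sep_w w_gt0 le_aB a_gt1.
have kb_gt1 := kron_size_gt1 sep_w w_gt0 le_bB b_gt1.
have dv_a : kron w a %| \prod_(i <- index_enum 'I_d) ('X - (v i)%:P).
  have -> : \prod_(i <- index_enum 'I_d) ('X - (v i)%:P) = rootpoly v finset.setT.
    by rewrite /rootpoly; apply: eq_bigl => i; rewrite inE.
  by rewrite -(dvdpZr _ _ c_neq0) -Dkp Dp rmorphM dvdp_mulr.
have [bm Da] := dvdp_prod_XsubC dv_a.
pose S := [set i in mask bm (index_enum 'I_d)]%SET.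
have {}Da : kron w a %= rootpoly v S.
  move: Da; rewrite big_uniq ?mask_uniq ?index_enum_uniq //=.
  by congr (_ %= _); apply: eq_bigl => i; rewrite inE.
have rootC : rootpoly v finset.setT = rootpoly v S * rootpoly v (~: S).
  rewrite /rootpoly (bigID (mem S)) /=; congr (_ * _).
    by apply: eq_bigl => i; rewrite inE.
  by apply: eq_bigl => i; rewrite !inE.
have /eqpfP Da' := Da.
have monS T : rootpoly v T \is monic by apply: monic_prod_XsubC.
rewrite (monicP (monS S)) divr1 in Da'.
set al := lead_coef (kron w a) in Da'.
have al_neq0 : al != 0.
  by rewrite lead_coef_eq0 -size_poly_gt0 ltnW.
have Db : al *: kron w b = c *: rootpoly v (~: S).
  apply: (mulfI (monic_neq0 (monS S))).
  by rewrite -!scalerAr -rootC -Dkp Dp rmorphM /= Da' -scalerAl.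
have S_proper : proper_part S.
  apply/andP; split; apply/eqP => DS.
    move: ka_gt1; rewrite (eqp_size Da) DS /rootpoly big_pred0 ?size_poly1 // => i.
    by rewrite inE.
  move: kb_gt1; rewrite -(size_scale _ al_neq0) Db (size_scale _ c_neq0) DS.
  rewrite finset.setCT /rootpoly big_pred0 ?size_poly1 // => i.
  by rewrite inE.
case/eqP: (defect_neq0 S S_proper); apply/eqP; rewrite subr_eq0; apply/eqP.
pose D T := dekron w B (rootpoly v T).
have DaD : a = al *: D S by rewrite -(kronK sep_w le_aB) Da' dekronZ.
have DbD : al *: b = c *: D (~: S).
  by rewrite -[b in LHS](kronK sep_w le_bB) -dekronZ Db dekronZ.
have DpD : p = c *: D finset.setT by rewrite -(kronK sep_w le_pB) Dkp dekronZ.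
have cD : c *: (D S * D (~: S)) = c *: D finset.setT.
  by rewrite scalerAr -DbD -scalerAr scalerAl -DaD -Dp.
by have /(congr1 ( *:%R c^-1)) := cD; rewrite !scalerA mulVf // !scale1r.
Qed.

Lemma map_fiber_kron (K : fieldType) (n : nat) (w : 'I_n -> nat) (f : {mpoly K[n]})
    (R : comNzRingType) (sigma : {rmorphism {poly K} -> R}) :
  kron w (map_mpoly (sigma \o polyC) f - (sigma 'X)%:MP) =
    map_poly sigma (fiber_poly (kron w f)).
Proof.
by rewrite !rmorphB /= kron_map kronC map_polyC -map_poly_comp.
Qed.

Lemma lead_coef_fiber_map (K : fieldType) (fh : {poly K}) (F : fieldType)
    (sigma : {rmorphism {poly K} -> F}) : (1 < size fh)%N ->
  sigma (lead_coef (fiber_poly fh)) != 0 /\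
  lead_coef (map_poly sigma (fiber_poly fh)) = sigma (lead_coef (fiber_poly fh)).
Proof.
move=> fh_gt1; have := rmorph_unit sigma (lead_coef_fiber_poly_unit fh_gt1).
by rewrite unitfE => nz; split=> //; rewrite lead_coef_map_id0 ?rmorph0.
Qed.

Lemma msize_shift (K L : fieldType) (n : nat) (iota : {rmorphism K -> L})
    (f : {mpoly K[n]}) (lambda : L) : (1 < msize f)%N ->
  (1 < msize (map_mpoly iota f + lambda%:MP) <= msize f)%N.
Proof.
move=> f_gt1; have f_neq0 : f != 0 by rewrite -msize_poly_eq0 -lt0n ltnW.
have Dlead := mlead_deg f_neq0.
have coefE m : m != 0%MM -> (map_mpoly iota f + lambda%:MP)@_m = iota f@_m.
  by move=> m_neq0; rewrite mcoeffD mcoeff_map_mpoly mcoeffC (negbTE m_neq0) mulr0 addr0.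
have lead_neq0 : mlead f != 0%MM by rewrite -mdeg_eq0 -lt0n -ltnS Dlead.
apply/andP; split.
  apply: leq_ltn_trans (msize_mdeg_lt (_ : mlead f \in _)).
    by rewrite lt0n mdeg_eq0.
  by rewrite mcoeff_msupp coefE // fmorph_eq0 mleadc_eq0.
rewrite msizeE; apply/bigmax_leqP_seq => m; rewrite mcoeff_msupp => fm_neq0 _.
have [->|m_neq0] := eqVneq m 0%MM; first by rewrite mdeg0 ltnW.
move: fm_neq0; rewrite coefE // fmorph_eq0 -mcoeff_msupp.
exact: msize_mdeg_lt.
Qed.

Lemma fiber_roots (K : fieldType) (fh : {poly K}) (F : fieldType)
    (sigma : {rmorphism {poly K} -> F}) (rs : seq F) :
    (1 < size fh)%N ->
    map_poly sigma (fiber_poly fh) %= \prod_(z <- rs) ('X - z%:P) ->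
  exists2 v : 'I_(size fh).-1 -> F,
    map_poly sigma (fiber_poly fh) =
      sigma (lead_coef (fiber_poly fh)) *: rootpoly v finset.setT & codom v = rs.
Proof.
move=> fh_gt1 Drs; have [lead_neq0 Dlead] := lead_coef_fiber_map sigma fh_gt1.
have size_rs : size rs == (size fh).-1.
  rewrite -eqSS -(size_prod_XsubC rs id) -(eqp_size Drs) size_map_poly_id0 //.
  by rewrite size_fiber_poly // prednK // ltnW.
exists (tnth (Tuple size_rs)); last by rewrite codomE map_tnth_enum.
have /eqpfP := Drs; rewrite Dlead (monicP (monic_prod_XsubC _ _ _)) divr1 => ->.
congr (_ *: _); rewrite [LHS](big_tuple _ _ (Tuple size_rs)) /rootpoly.
by apply: eq_bigl => i; rewrite inE.
Qed.

(** The total defect of the generic fiber is nonzero, so one of its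
    coefficients is [q(f)] with [q] nonzero; the same coefficient for the fiber
    over [tau] is [q(tau)]. *)
Lemma irreducible_fibers (K : fieldType) (n : nat) (f : {mpoly K[n]}) :
    (0 < n)%N -> perfect_field K -> nonconstant f -> non_composite f ->
  exists2 q : {poly K}, q != 0 &
    forall (L : closedFieldType) (iota : {rmorphism K -> L}) (lambda : L),
      ~~ root (map_poly iota q) (- lambda) -> shift_irreducible iota f lambda.
Proof.
move=> n_gt0 perf nc_f ncomp_f.
have closed_f := noncomposite_closed n_gt0 nc_f ncomp_f.
have [i0 di0] := noncomposite_partial_neq0 perf nc_f ncomp_f.
have [w [w_gt0 sep_w weight_neq0]] := kronecker_weights K (msize f) i0.
have deriv_fh := kron_deriv_neq0 sep_w (leqnn _) weight_neq0 di0.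
have f_gt1 := nonconstant_msize nc_f.
have fh_gt1 := kron_size_gt1 sep_w w_gt0 (leqnn _) f_gt1.
set fh := kron w f in deriv_fh fh_gt1.
pose d := (size fh).-1; have size_fh : size fh = d.+1 by rewrite prednK // ltnW.
have fiber_neq0 : map_poly (@FracField.tofrac {mpoly K[n]} \o horner_alg f)
    (fiber_poly fh) != 0.
  exact: map_unit_lead_neq0 (lead_coef_fiber_poly_unit fh_gt1).
have [E [rs Drs gen_rs]] := splitting_field_exists fiber_neq0.
pose sigma := in_alg E \o @FracField.tofrac {mpoly K[n]} \o horner_alg f.
have {}Drs : map_poly sigma (fiber_poly fh) %= \prod_(z <- rs) ('X - z%:P).
  by rewrite map_poly_comp map_poly_comp -[map_poly (in_alg E) _]map_poly_comp in Drs *.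
have [v Dv codom_v] := fiber_roots fh_gt1 Drs.
have defect_neq0 : total_defect w (msize f) v != 0.
  apply: (@generic_total_defect_neq0 _ _ f) => //; first by rewrite codom_v.
have [m coef_neq0] : exists m, (total_defect w (msize f) v)@_m != 0.
  by exists (mlead (total_defect w (msize f) v)); rewrite mleadc_eq0.
have size_fiber : size (fiber_poly fh) = d.+1 by rewrite size_fiber_poly.
have [q Dq] := total_defect_coef w (msize f) m size_fiber
  (lead_coef_fiber_poly_unit fh_gt1).
exists q => [|L iota lambda].
  by apply: contraNneq coef_neq0 => q0; rewrite (Dq _ sigma v Dv) q0 raddf0.
pose tau := horner_eval (- lambda) \o map_poly iota : {rmorphism {poly K} -> L}.
move=> q_neq0; have [rL DrL] := closed_field_poly_normal (map_poly tau (fiber_poly fh)).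
have [lead_neq0 Dlead] := lead_coef_fiber_map tau fh_gt1.
have [|u Du _] := @fiber_roots _ _ _ tau rL fh_gt1.
  by rewrite DrL eqp_scale // Dlead.
have Dp : map_mpoly iota f + lambda%:MP = map_mpoly (tau \o polyC) f - (tau 'X)%:MP.
  apply/mpolyP => mu; rewrite mcoeffD mcoeffB !mcoeff_map_mpoly !mcoeffC /=.
  by rewrite /horner_eval map_polyC hornerC map_polyX hornerX mulNr opprK.
rewrite /shift_irreducible Dp.
apply: (irreducible_of_total_defect w_gt0 sep_w _ lead_neq0 (v := u)).
- by rewrite -Dp; apply: msize_shift.
- by rewrite map_fiber_kron Du.
- apply: contraNneq q_neq0 => defect0.
  by rewrite /root -[_.[_]]/(tau q) -(Dq _ tau u Du) defect0 mcoeff0.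
Qed.

Lemma noncomposite_irreducible_cofinite (K : fieldType) (n : nat)
    (f : {mpoly K[n]}) (L : closedFieldType) (iota : {rmorphism K -> L}) :
    (0 < n)%N -> perfect_field K -> nonconstant f -> non_composite f ->
  exists s : seq L, forall lambda, lambda \notin s -> shift_irreducible iota f lambda.
Proof.
move=> n_gt0 perf nc_f ncomp_f.
have [q q_neq0 irr_q] := irreducible_fibers n_gt0 perf nc_f ncomp_f.
have [rs Drs] := closed_field_poly_normal (map_poly iota q).
exists (map -%R rs) => lambda; rewrite -[lambda in X in X -> _]opprK => rs'lambda.
apply: irr_q; rewrite Drs rootZ ?lead_coef_eq0 ?map_poly_eq0 // root_prod_XsubC.
by apply: contra rs'lambda => rs_lambda; apply: map_f.
Qed.

(** A root of [X * \prod_(z <- s) (X - z) + 1] cannot be in [s]. *)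
Lemma closed_field_avoid (L : closedFieldType) (s : seq L) : exists x, x \notin s.
Proof.
pose p := 'X * \prod_(z <- s) ('X - z%:P) + 1 : {poly L}.
have mon_s : \prod_(z <- s) ('X - z%:P) \is monic by apply: monic_prod_XsubC.
have size_p : size p != 1%N.
  rewrite size_polyDl mulrC size_mulX ?monic_neq0 // size_prod_XsubC //.
  by rewrite size_poly1.
have /closed_rootP[x] := size_p; rewrite /root => /eqP px0.
exists x; apply/negP => s_x; move: px0.
rewrite hornerD hornerM hornerC; have /eqP -> : root (\prod_(z <- s) ('X - z%:P)) x.
  by rewrite root_prod_XsubC.
by rewrite mulr0 add0r => /eqP; rewrite oner_eq0.
Qed.

(** Over an algebraically closed field, [F + lambda] splits into linear factors,
    so [F(g) + lambda] is reducible as soon as [F] has degree at least [2]. *)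
Lemma irreducible_noncomposite (K : fieldType) (n : nat) (f : {mpoly K[n]})
    (L : closedFieldType) (iota : {rmorphism K -> L}) (lambda : L) :
    (0 < n)%N -> nonconstant f -> shift_irreducible iota f lambda -> non_composite f.
Proof.
move=> n_gt0 nc_f [_ _ irr_f] F g Df.
have F_gt1 := nonconstant_outer nc_f Df.
have nc_g := nonconstant_inner nc_f Df.
pose gL := map_mpoly iota g.
have nc_gL : nonconstant gL.
  move=> c Dg; apply: (nc_g (g@_0%MM)); apply/mpolyP => m; rewrite mcoeffC.
  have Dcoef : iota g@_m = c * (m == 0%MM)%:R.
    by rewrite -mcoeff_map_mpoly -/gL Dg mcoeffC.
  have [->|m_neq0] := eqVneq m 0%MM; first by rewrite mulr1.
  by apply: (fmorph_inj iota); rewrite Dcoef (negbTE m_neq0) !mulr0 rmorph0.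
pose FL := map_poly iota F + lambda%:P.
have DfL : map_mpoly iota f + lambda%:MP = horner_alg gL FL.
  rewrite rmorphD /= horner_algC alg_mpolyC; congr (_ + _); rewrite Df.
  rewrite /horner_alg /= /horner_morph -horner_map -!map_poly_comp.
  congr (_.[_]); apply: eq_map_poly => c /=.
  by rewrite !alg_mpolyC map_mpolyC.
have size_FL : size FL = size F.
  by rewrite size_polyDl size_map_poly // (leq_ltn_trans (size_polyC_leq1 _)).
have /closed_rootP[z] : size FL != 1%N by rewrite size_FL gtn_eqF.
case/factor_theorem => G DG.
have FL_neq0 : FL != 0 by rewrite -size_poly_gt0 size_FL ltnW.
have /andP[G_neq0 _] : (G != 0) && ('X - z%:P != 0).
  by rewrite -negb_or -mulf_eq0 -DG.
have unit_size (H : {poly L}) : H != 0 -> horner_alg gL H \is a GRing.unit -> size H = 1%N.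
  move=> H_neq0; rewrite mpoly_unitE => /msize_poly1P[c _ Dc].
  have DH : H = c%:P.
    by apply: (horner_alg_inj n_gt0 nc_gL); rewrite horner_algC alg_mpolyC.
  by move: H_neq0; rewrite DH size_polyC polyC_eq0 => ->.
have size_F : size F = (size G).+1.
  by rewrite -size_FL DG size_Mmonic ?monicXsubC // size_XsubC addn2.
have [|/unit_size G1|/unit_size X1] := irr_f (horner_alg gL G) (horner_alg gL ('X - z%:P)).
- by rewrite DfL DG rmorphM.
- by rewrite size_F G1.
- by move: X1; rewrite size_XsubC polyXsubC_eq0 => /(_ isT).
Qed.

(** * Kernels of derivations *)

Section Derivations.

Variables (K : fieldType) (A : comAlgType K) (D : {linear A -> A}).
Hypothesis derD : is_derivation D.

Lemma derivation_scalar c : D c%:A = 0.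
Proof.
rewrite linearZ /=; have /eqP := derD 1 1.
by rewrite !mulr1 mul1r -{1}[D 1]addr0 (inj_eq (addrI _)) eq_sym => /eqP ->; rewrite scaler0.
Qed.

Lemma derivation_chain g q : D (horner_alg g q) = horner_alg g q^`() * D g.
Proof.
elim/poly_ind: q => [|q c IHq]; first by rewrite deriv0 !raddf0 mul0r.
rewrite derivD derivM derivX derivC addr0 mulr1 rmorphD rmorphM /= horner_algX.
rewrite horner_algC raddfD /= derivation_scalar addr0 derD IHq.
by rewrite rmorphD rmorphM /= horner_algX; ring.
Qed.

End Derivations.

Lemma jacobian_identity (R : comNzRingType) (a b c d x y : R) :
  (a * b - c * d) * (x * y) = (a * y) * (b * x) - (c * x) * (d * y).
Proof. by ring. Qed.

Lemma jacobian_leibniz (R : comNzRingType) (a b c d p q x y : R) :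
  a * (x * q + p * y) - b * (c * q + p * d) = (a * x - b * c) * q + p * (a * y - b * d).
Proof. by ring. Qed.

Lemma integral_lead_coef (R S : comNzRingType) (rho : {rmorphism R -> S})
    (P : {poly R}) x :
  root (map_poly rho P) x -> integralOver rho (rho (lead_coef P) * x).
Proof.
set l := lead_coef P; move=> /rootP Px0.
have size_P : (size (map_poly rho P) <= size P)%N by apply: size_poly.
have [P_le1|P_gt1] := leqP (size P) 1.
  move: Px0; rewrite (size1_polyC P_le1) map_polyC hornerC /= => Pc0.
  rewrite /l (size1_polyC P_le1) lead_coefC Pc0 mul0r; exact: integral0.
pose J := (size P).-2; have Dsize : size P = J.+2 by rewrite /J; case: (size P) P_gt1 => [|[]].
pose c (i : nat) : R := P`_i * l ^+ (J - i).
have Dc i : rho (c i) = rho P`_i * rho l ^+ (J - i) by rewrite rmorphM rmorphXn.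
pose Q := 'X^(J.+1) + \poly_(i < J.+1) c i.
exists Q.
  by rewrite monicE lead_coefDl ?lead_coefXn // size_polyXn ltnS size_poly.
have DP : \sum_(i < J.+2) rho P`_i * x ^+ i = 0.
  rewrite -[RHS]Px0 (horner_coef_wide _ (leq_trans size_P (eq_leq Dsize))).
  by apply: eq_bigr => i _; rewrite coef_map.
have Dl : rho P`_J.+1 = rho l by rewrite /l /lead_coef Dsize.
have size_Q : (size (map_poly rho Q) <= J.+2)%N.
  apply: leq_trans (size_poly _ _) _; rewrite (leq_trans (size_polyD _ _)) //.
  by rewrite geq_max size_polyXn leqnn /= (leq_trans (size_poly _ _)).
rewrite /root (horner_coef_wide _ size_Q); apply/eqP.
transitivity (rho l ^+ J * \sum_(i < J.+2) rho P`_i * x ^+ i); last by rewrite DP mulr0.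
rewrite mulr_sumr; apply: eq_bigr => i _; rewrite coef_map coefD coefXn coef_poly.
have [lt_iJ|le_Ji] := ltnP i J.+1.
  rewrite (ltn_eqF lt_iJ) add0r /= Dc exprMn.
  have -> : rho l ^+ J = rho l ^+ (J - i) * rho l ^+ i by rewrite -exprD subnK.
  by ring.
have -> : nat_of_ord i = J.+1 by apply/eqP; rewrite eqn_leq le_Ji -ltnS ltn_ord.
by rewrite eqxx addr0 /= rmorph1 mul1r Dl exprMn mulrA -exprSr.
Qed.

Lemma natr_inj_pchar0 (R : idomainType) (m k : nat) :
  [pchar R] =i pred0 -> m%:R = k%:R :> R -> m = k.
Proof.
move=> /(pcharf0P R)-char0.
wlog le_mk : m k / (m <= k)%N.
  move=> wl; case/orP: (leq_total m k) => le eq_mk; first exact: wl.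
  by apply/esym/wl.
move=> eq_mk; have := char0 (k - m)%N.
rewrite natrB // eq_mk subrr eqxx => /esym; rewrite subn_eq0 => le_km.
by apply/eqP; rewrite eqn_leq le_mk.
Qed.

Lemma mulrn_cross (R : idomainType) (a b : R) (p q r s : nat) :
  (a *+ p) * (b *+ q) = (a *+ r) * (b *+ s) -> a != 0 -> b != 0 ->
  (p * q)%:R = (r * s)%:R :> R.
Proof.
rewrite -[a *+ p]mulr_natr -[b *+ q]mulr_natr -[a *+ r]mulr_natr -[b *+ s]mulr_natr.
move=> eq_ab a_neq0 b_neq0; apply: (mulfI (mulf_neq0 a_neq0 b_neq0)).
by rewrite !natrM mulrACA eq_ab mulrACA.
Qed.

Section Jacobian.

Variables (K : fieldType) (n : nat) (f : {mpoly K[n]}).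

Definition jacobian (ij : 'I_n * 'I_n) (h : {mpoly K[n]}) : {mpoly K[n]} :=
  f^`M(ij.2) * h^`M(ij.1) - f^`M(ij.1) * h^`M(ij.2).

Lemma jacobian_is_linear ij : linear (jacobian ij).
Proof.
move=> c p q; rewrite /jacobian !mderivD !mderivZ !mulrDr -!scalerAr.
by rewrite scalerBr opprD addrACA.
Qed.

HB.instance Definition _ ij :=
  GRing.isLinear.Build K {mpoly K[n]} {mpoly K[n]} *:%R (jacobian ij)
    (jacobian_is_linear ij).

Lemma jacobian_derivation ij : is_derivation (jacobian ij).
Proof.
by move=> p q /=; rewrite /jacobian !mderivM; apply: jacobian_leibniz.
Qed.

Hypothesis char0 : [pchar K] =i pred0.

Lemma mcoeff_euler i (p : {mpoly K[n]}) m : (p^`M(i) * 'X_i)@_m = p@_m *+ m i.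
Proof.
have [m0|mi_neq0] := eqVneq (m i) 0%N.
  rewrite m0 mulr0n; apply/eqP; rewrite mcoeff_eq0.
  rewrite (perm_mem (msuppMX _ _)); apply/negP => /mapP[m' _ Dm].
  by move: m0; rewrite Dm mnmDE mnm1E eqxx.
have Dm : (m - U_(i) + U_(i))%MM = m by rewrite submK // lep1mP.
rewrite -{1}Dm addmC mcoeffMX mcoeff_deriv Dm mnmBE mnm1E eqxx subn1 prednK //.
by rewrite lt0n.
Qed.

Lemma mlead_euler_le i (p : {mpoly K[n]}) : (mlead (p^`M(i) * 'X_i) <= mlead p)%O.
Proof.
have [->|e_neq0] := eqVneq (p^`M(i) * 'X_i) 0; first by rewrite mlead0 le0m.
apply: msupp_le_mlead; have := mlead_supp e_neq0.
rewrite !mcoeff_msupp mcoeff_euler; apply: contraNneq => ->.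
by rewrite mul0rn.
Qed.

(** The Euler operators [X_i d/dX_i] multiply each monomial by an exponent, so
    the coefficient of the product of the leading monomials in
    [X_i X_j * jacobian (i, j) h] is, up to the leading coefficients, a minor
    of the matrix of leading exponents. *)
Lemma jacobian_lead h : f != 0 -> h != 0 -> (forall ij, jacobian ij h = 0) ->
  forall i j, (mlead f i * mlead h j = mlead f j * mlead h i)%N.
Proof.
move=> f_neq0 h_neq0 jac0 i j.
have := jac0 (i, j); rewrite /jacobian /= => jac_ij.
have /(congr1 (fun p => p@_(mlead f + mlead h))) :=
  jacobian_identity f^`M(j) h^`M(i) f^`M(i) h^`M(j) 'X_i 'X_j.
rewrite jac_ij mul0r mcoeff0 mcoeffB.
rewrite !mleadcMW ?mlead_euler_le // !mcoeff_euler => /esym/eqP.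
rewrite subr_eq0 => /eqP/mulrn_cross eq_nat; apply/esym.
by apply: natr_inj_pchar0 char0 _; apply: eq_nat; rewrite mleadc_eq0.
Qed.

Hypothesis n_gt0 : (0 < n)%N.
Hypothesis nc_f : nonconstant f.

Let a := mdeg (mlead f).

Lemma nonconstant_lead : f != 0 /\ (0 < a)%N.
Proof.
have f_gt1 := nonconstant_msize nc_f.
have f_neq0 : f != 0 by rewrite -msize_poly_eq0 -lt0n ltnW.
by split=> //; rewrite /a -ltnS mlead_deg.
Qed.

(** The monomial of degree [k] in the direction of the leading monomial of [f],
    if there is one. *)
Definition ray (k : nat) : 'X_{1..n} := [multinom (k * mlead f i %/ a)%N | i < n].

Lemma lead_on_ray h : h != 0 -> (forall ij, jacobian ij h = 0) ->
  mlead h = ray (mdeg (mlead h)).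
Proof.
move=> h_neq0 jac0; have [f_neq0 a_gt0] := nonconstant_lead.
have cross := jacobian_lead f_neq0 h_neq0 jac0.
apply/mnmP => i; rewrite mnmE.
have -> : (mdeg (mlead h) * mlead f i = mlead h i * a)%N.
  rewrite /a !mdegE big_distrl big_distrr /=; apply: eq_bigr => j _.
  by rewrite mulnC cross mulnC.
by rewrite mulnK.
Qed.

Lemma jacobian_mul ij p q : jacobian ij p = 0 -> jacobian ij q = 0 ->
  jacobian ij (p * q) = 0.
Proof. by move=> p0 q0; rewrite (jacobian_derivation ij p q) /= p0 q0 mul0r mulr0 addr0. Qed.

Lemma jacobian_exp ij p k : jacobian ij p = 0 -> jacobian ij (p ^+ k) = 0.
Proof.
move=> p0; elim: k => [|k IHk]; last by rewrite exprS jacobian_mul.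
by rewrite -(scale1r (_ ^+ 0)) expr0 (derivation_scalar (jacobian_derivation ij)).
Qed.

Lemma jacobian_self ij : jacobian ij f = 0.
Proof. by rewrite /jacobian mulrC subrr. Qed.

(** All leading monomials in the common kernel lie on one ray, so this kernel
    has at most one dimension in each degree; the quadratically many products
    [f ^+ i * h ^+ j] cannot be linearly independent. *)
Lemma kernel_algebraic h : (forall ij, jacobian ij h = 0) ->
  exists2 P : {poly {poly K}}, P != 0 & root (map_poly (horner_alg f) P) h.
Proof.
move=> jac0; have [f_neq0 a_gt0] := nonconstant_lead.
have [->|h_neq0] := eqVneq h 0.
  by exists 'X; rewrite ?polyX_eq0 // map_polyX /root hornerX.
(* [M * M] products of degree at most [N], and [N + 1 < M * M]. *)
pose e := mdeg (mlead h); pose N := ((a + e) * (a + e))%N; pose M := (a + e).+1.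
pose V (p : 'I_(M * M)) : {mpoly K[n]} := f ^+ (p %/ M) * h ^+ (p %% M).
have V_neq0 p : V p != 0 by rewrite mulf_neq0 ?expf_neq0.
have V_size p : (msize (V p) <= N.+1)%N.
  rewrite -(mlead_deg (V_neq0 p)) ltnS mleadM ?expf_neq0 // !mleadX //.
  rewrite mdegD !mdegMn -/a -/e.
  have lt_div : (p %/ M < M)%N by rewrite ltn_divLR ?ltn_ord.
  have lt_mod : (p %% M < M)%N by rewrite ltn_mod.
  rewrite /N mulnDl leq_add // leq_mul2l -ltnS; first by rewrite lt_div orbT.
  by rewrite lt_mod orbT.
pose Mx : 'M[K]_(M * M, N.+1) := \matrix_(p, k) (V p)@_(ray k).
have : kermx Mx != 0.
  rewrite kermx_eq0 /row_free neq_ltn (leq_ltn_trans (rank_leq_col _)) //.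
  by rewrite /N /M; nia.
case/rowV0Pn => u /sub_kermxP uM0 u_neq0.
pose y := \sum_p u 0 p *: V p.
have y0 : y = 0.
  apply/eqP/idPn => y_neq0.
  have jacy ij : jacobian ij y = 0.
    rewrite /y (linear_sum (jacobian ij)) big1 // => p _.
    rewrite linearZ /= jacobian_mul ?scaler0 //; apply: jacobian_exp => //.
    exact: jacobian_self.
  have le_yN : (msize y <= N.+1)%N.
    apply: leq_trans (msize_sum _ _ _) _; apply/bigmax_leqP => p _.
    exact: leq_trans (msizeZ_le _ _) (V_size p).
  have lt_k : (mdeg (mlead y) < N.+1)%N by rewrite (leq_trans _ le_yN) // mlead_deg.
  have /matrixP/(_ 0 (Ordinal lt_k)) := uM0; rewrite !mxE => coef0.
  have Dcoef : y@_(ray (mdeg (mlead y))) = 0.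
    rewrite -[RHS]coef0 /y (raddf_sum (mcoeff _)); apply: eq_bigr => p _ /=.
    by rewrite mcoeffZ mxE.
  by have := y_neq0; rewrite -mleadc_eq0 (lead_on_ray y_neq0 jacy) Dcoef eqxx.
pose P : {poly {poly K}} := \sum_p (u 0 p *: 'X^(p %/ M))%:P * 'X^(p %% M).
exists P.
  have /rV0Pn[p0 up0_neq0] := u_neq0.
  apply: contraNneq up0_neq0 => P0.
  have := congr1 (fun R : {poly {poly K}} => R`_(p0 %% M)`_(p0 %/ M)) P0.
  rewrite !coef0 coef_sum coef_sum (bigD1 p0) //= big1 ?addr0 => [|p p_neq].
    by rewrite coefCM coefXn eqxx mulr1 coefZ coefXn eqxx mulr1 => ->.
  rewrite coefCM coefXn; case: eqP => [eq_mod|_]; last by rewrite mulr0 coef0.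
  rewrite mulr1 coefZ coefXn; case: eqP => [eq_div|_]; last by rewrite mulr0.
  case/eqP: p_neq; apply: val_inj => /=.
  by rewrite (divn_eq p M) (divn_eq p0 M) eq_mod eq_div.
rewrite /root /P rmorph_sum horner_sum -[X in _ == X]y0; apply/eqP.
apply: eq_bigr => p _; rewrite rmorphM /= map_polyC map_polyXn /=.
rewrite hornerM hornerC hornerXn linearZ rmorphXn /= horner_algX.
by rewrite /V -mulrA mulr_algl.
Qed.

(** An element [h] of the common kernel satisfies [l(f) * h = p(f)] with [l]
    nonzero; comparing degrees after division of [p] by [l], [h] is the
    quotient evaluated at [f]. *)
Lemma closed_kernel h : closed_mpoly f -> (forall ij, jacobian ij h = 0) ->
  exists q, h = horner_alg f q.
Proof.
move=> /closed_mpolyP cl_f jac0; have [P P_neq0 Ph0] := kernel_algebraic jac0.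
have [p Dp] := cl_f _ (integral_lead_coef Ph0).
set l := lead_coef P in Dp; have l_neq0 : l != 0 by rewrite lead_coef_eq0.
exists (p %/ l); apply/eqP; rewrite -subr_eq0; apply/eqP.
set k := h - _; apply/eqP/idPn => k_neq0.
have Dlk : horner_alg f l * k = horner_alg f (p %% l).
  rewrite /k mulrBr Dp -rmorphM -rmorphB /= {1}(divp_eq p l) mulrC addrAC.
  by rewrite mulrC subrr add0r.
have [w [w_gt0 sep_w _]] := kronecker_weights K (maxn (msize f) (msize k)) (Ordinal n_gt0).
have fh_gt1 := kron_size_gt1 sep_w w_gt0 (leq_maxl _ _) (nonconstant_msize nc_f).
have kk_neq0 : kron w k != 0.
  apply: contraNneq k_neq0 => kk0.
  rewrite -(kronK sep_w (leq_maxr _ _ : (msize k <= _)%N)) kk0.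
  by apply/eqP/mpolyP => m; rewrite mcoeff_dekron coef0 mcoeff0 if_same.
have := congr1 (kron w (R := K)) Dlk; rewrite rmorphM /= !kron_horner => Dkron.
have lf_neq0 : l \Po kron w f != 0 by rewrite comp_poly_eq0.
have r_neq0 : p %% l != 0.
  rewrite -(comp_poly_eq0 _ fh_gt1) -Dkron; exact: mulf_neq0.
have : (size (l \Po kron w f)%R <= size ((p %% l) \Po kron w f)%R)%N.
  by rewrite dvdp_leq ?comp_poly_eq0 // -Dkron dvdp_mulr.
rewrite leqNgt; case/negP.
have lt_rl : (size (p %% l)%R < size l)%N by rewrite ltn_modp.
have pred_lt (s t : nat) : (0 < s)%N -> (s < t)%N -> (s.-1 < t.-1)%N.
  by case: s t => [|s] [|t].
have lt_pred (s t : nat) : (s.-1 < t.-1)%N -> (s < t)%N by case: s t => [|s] [|t].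
apply: lt_pred; rewrite !size_comp_poly ltn_pmul2r; last by case: (size _) fh_gt1 => [|[]].
by apply: pred_lt => //; rewrite size_poly_gt0.
Qed.

End Jacobian.

Lemma noncomposite_kernel (K : fieldType) (n : nat) (f : {mpoly K[n]}) :
    (0 < n)%N -> [pchar K] =i pred0 -> nonconstant f -> non_composite f ->
  is_kernel_of_derivations f
    (fun ij => jacobian f ij : {linear {mpoly K[n]} -> {mpoly K[n]}}).
Proof.
move=> n_gt0 char0 nc_f ncomp_f; split; first exact: jacobian_derivation.
have closed_f := noncomposite_closed n_gt0 nc_f ncomp_f.
apply/seteqP; split=> [h /subalg_genP[q ->] ij _ /=|h ker_h].
  by rewrite (derivation_chain (jacobian_derivation f ij)) /= jacobian_self mulr0.
apply/subalg_genP; apply: (closed_kernel char0 n_gt0 nc_f closed_f) => ij.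
exact: (ker_h ij Logic.I).
Qed.

(** A derivation killing [F(g)] kills [g], as [F'(g)] is nonzero in
    characteristic [0]. *)
Lemma kernel_noncomposite (K : fieldType) (n : nat) (f : {mpoly K[n]})
    (I : Type) (D : I -> {linear {mpoly K[n]} -> {mpoly K[n]}}) :
    (0 < n)%N -> [pchar K] =i pred0 -> nonconstant f ->
  is_kernel_of_derivations f D -> non_composite f.
Proof.
move=> n_gt0 char0 nc_f [derD Dker] F g Df.
have F_gt1 := nonconstant_outer nc_f Df.
have nc_g := nonconstant_inner nc_f Df.
have dF_neq0 : F^`() != 0.
  apply/eqP => /polyP/(_ (size F).-2).
  rewrite coef_deriv coef0 -mulr_natr => /eqP; rewrite mulf_eq0.
  have Dsize : (size F).-2.+1 = (size F).-1 by case: (size F) F_gt1 => [|[]].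
  have F_neq0 : F != 0 by rewrite -size_poly_gt0 ltnW.
  rewrite Dsize -/(lead_coef F) lead_coef_eq0 (negbTE F_neq0) /=.
  by rewrite ((pcharf0P K).1 char0) -Dsize.
have [L DL] : exists L, g = horner_alg f L.
  apply/subalg_genP; rewrite Dker => i _ /=.
  have : D i f = 0.
    have : subalg_gen f f by apply/subalg_genP; exists 'X; rewrite horner_algX.
    by rewrite {1}Dker => /(_ i Logic.I).
  rewrite Df (derivation_chain (derD i)) => /eqP; rewrite mulf_eq0 => /orP[|/eqP //].
  by move=> /eqP/(horner_alg_eq0 n_gt0 nc_g)/eqP; rewrite (negbTE dF_neq0).
exact: generator_degree1 n_gt0 _ _ _ _ nc_f Df DL.
Qed.

Theorem theorem1 (K : fieldType) (n : nat) (hn : (1 <= n)%N)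
    (f : {mpoly K[n]}) (hf : nonconstant f) :
  [/\ (* (i), (ii), (iii) *)
      (non_composite f <->
         maximal_element (@one_generated_subalgs K n) (subalg_gen f)),
      (non_composite f <-> closed_mpoly f),
      (* (iv), (v) *)
      (perfect_field K ->
       forall (L : closedFieldType) (iota : {rmorphism K -> L}),
         is_algebraic_closure iota ->
         (non_composite f <->
            exists s : seq L, forall lambda : L,
              lambda \notin s -> shift_irreducible iota f lambda) /\
         (non_composite f <->
            exists lambda : L, shift_irreducible iota f lambda))
    & (* (vi), with an arbitrary family and with a finite one *)
      ([pchar K] =i pred0 ->
         (non_composite f <->
            exists (I : Type) (D : I -> {linear {mpoly K[n]} -> {mpoly K[n]}}),
              is_kernel_of_derivations f D) /\
         (non_composite f <->
            exists (I : finType) (D : I -> {linear {mpoly K[n]} -> {mpoly K[n]}}),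
              is_kernel_of_derivations f D))].
Proof.
split.
- exact: noncomposite_maximal.
- by split; [exact: noncomposite_closed | exact: closed_noncomposite].
- move=> perf L iota _.
  have iv : non_composite f -> exists s : seq L, forall lambda : L,
      lambda \notin s -> shift_irreducible iota f lambda.
    exact: noncomposite_irreducible_cofinite.
  have v_i lambda : shift_irreducible iota f lambda -> non_composite f.
    exact: irreducible_noncomposite.
  split; split=> [|[s irr_s]]; [exact: iv | | | exact: v_i irr_s].
    by have [lambda s'lambda] := closed_field_avoid s; apply/v_i/irr_s/s'lambda.
  move=> /iv[s irr_s]; have [lambda s'lambda] := closed_field_avoid s.
  by exists lambda; apply: irr_s.
- move=> char0; split; split=> [ncomp_f|[I [D kerD]]].
  + by exists ('I_n * 'I_n)%type; eexists; exact: noncomposite_kernel.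
  + exact: kernel_noncomposite kerD.
  + by exists ('I_n * 'I_n)%type; eexists; exact: noncomposite_kernel.
  + exact: kernel_noncomposite kerD.
Qed.
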